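(* Let $\mathcal{M}$ be the generic hypergraph for the class $\mathcal{C}$ of all finite hypergraphs $\mathcal{A}$ with $\emptyset\leqslant\mathcal{A}$ (with respect to $\leqslant$), and let $\mathcal{G}$ be the generic flat pregeometry, i.e. the generic structure for the class $\mathfrak{C}$ of all finite flat pregeometries (with respect to $\sqsubseteq$). Then $G_{\mathcal{M}}\cong\mathcal{G}$.
   Context: Pregeometries. A pregeometry $G$ on a (possibly infinite) set $M$ is a function $d=d_G$ from the finite subsets of $M$ to $\mathbb{N}$ such that $d(\emptyset)=0$, $d(A)\le d(A\cup\{x\})\le d(A)+1$, and $d(A\cup B)+d(A\cap B)\le d(A)+d(B)$. A finite $A$ is independent if $d(A)=|A|$; an arbitrary set is independent if all its finite subsets are; $d(Y)=\sup\{|Y_0|: Y_0\subseteq Y \text{ independent}\}$. For finite $A$, $\mathrm{cl}_G(A)=\{x: d(A\cup\{x\})=d(A)\}$, and $\mathrm{cl}_G(Y)=\bigcup\{\mathrm{cl}_G(Y_0): Y_0\subseteq Y\text{ finite}\}$. $Y$ is closed in $G$ if $\mathrm{cl}_G(Y)=Y$. A subpregeometry $H\subseteq G$ is the restriction of $d_G$ to subsets of a subset of $M$. Isomorphisms of pregeometries are dimension-preserving bijections. Flatness. For a finite collection $\Sigma=\{E_1,\dots,E_k\}$ of finite-dimensional closed sets of $G$ let $\Delta_G(\Sigma)=\sum_{\emptyset\ne s\subseteq\{1,\dots,k\}}(-1)^{|s|+1}d_G\left(\bigcap_{i\in s}E_i\right)$. $G$ is flat if $\Delta_G(\Sigma)\ge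 d_G(\bigcup\Sigma)$ for every such $\Sigma$. For $H\subseteq G$, $H\sqsubseteq G$ means that for every finite collection $\Sigma$ of finite-dimensional closed sets of $G$, $\Delta_H(\{E\cap H: E\in\Sigma\})\le\Delta_G(\Sigma)$. Hypergraphs. A hypergraph $\mathcal{A}=(M,R)$ is a set $M$ with a set $R$ of non-empty finite subsets of $M$. For $P\subseteq M$, $R[P]=\{e\in R: e\subseteq P\}$. For finite $Y\subseteq M$, $\delta_{\mathcal{A}}(Y)=|Y|-|R[Y]|$. For finite $X\subseteq M$, $d_{\mathcal{A}}(X)=\inf\{\delta_{\mathcal{A}}(Y): X\subseteq Y\subseteq M,\ Y\text{ finite}\}$. If $d_{\mathcal{A}}$ is non-negative, it is the dimension function of a pregeometry $G_{\mathcal{A}}$ on $M$. For $P\subseteq M$ and finite $X\subseteq M$ let $\delta_{\mathcal{A}}(X/P)=|X\setminus P|-|R[X\cup P]\setminus R[P]|$. Write $P\leqslant\mathcal{A}$ (equivalently $(P,R[P])\leqslant\mathcal{A}$) if $\delta_{\mathcal{A}}(X/P)\ge 0$ for every finite $X\subseteq M$. The condition $\emptyset\leqslant\mathcal{A}$ is equivalent to $d_{\mathcal{A}}$ being non-negative. Generic structures. Given a countable (up to isomorphism) class $\mathbb{C}$ of finite structures closed under isomorphism, with a distinguished substructure relation $\leqslant_{\mathbb D}$ for which $\mathbb{C}$ is an amalgamation class, the generic structure for $\mathbb{C}$ is the countable structure $M$, unique up to isomorphism, such that: (i) up to isomorphism, the finite $A\leqslant_{\mathbb D} M$ are exactly the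 members of $\mathbb{C}$; (ii) whenever $A\leqslant_{\mathbb D}M$ is finite and $A\leqslant_{\mathbb D}B\in\mathbb{C}$, there is an embedding $f:B\to M$ fixing $A$ pointwise with $f[B]\leqslant_{\mathbb D}M$; (iii) every finite subset of $M$ is contained in a finite $A\leqslant_{\mathbb D}M$. Here $(\mathbb{C},\leqslant_{\mathbb D})$ is $(\mathcal{C},\leqslant)$ for $\mathcal{M}$ and $(\mathfrak{C},\sqsubseteq)$ for $\mathcal{G}$; both generic structures exist. *)

(* Defs.v *)
From HB Require Import structures.
From mathcomp Require Import all_boot all_order all_algebra.
From mathcomp Require Import finmap.
From mathcomp Require Import boolp classical_sets.

Set Implicit Arguments.
Unset Strict Implicit.
Unset Printing Implicit Defensive.

Import Order.TTheory GRing.Theory Num.Theory.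

Local Open Scope fset_scope.

Record pregeometry (M : choiceType) := Pregeometry {
  pdim :> {fset M} -> nat;
  pdim0 : pdim fset0 = 0%N;
  pdim_mono : forall (A : {fset M}) x, (pdim A <= pdim (x |` A))%N;
  pdim_incr : forall (A : {fset M}) x, (pdim (x |` A) <= (pdim A).+1)%N;
  pdim_submod : forall A B : {fset M},
    (pdim (A `|` B) + pdim (A `&` B) <= pdim A + pdim B)%N }.

Section Pregeometry.
Variables (M : choiceType) (G : pregeometry M).

Definition independent (A : {fset M}) : Prop := G A = #|` A|.

Definition fin_dimensional (Y : set M) : Prop :=
  exists n : nat, forall A : {fset M},
    ([set` A] `<=` Y)%classic -> independent A -> (#|` A| <= n)%N.

(* [d(Y)] as a supremum of sizes of finite independent subsets.  An infinite
   independent set has arbitrarily large finite independent subsets, so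
   restricting to finite ones does not change the supremum.  When [Y] is not
   finite-dimensional the value is the junk value 0. *)
Definition sdim (Y : set M) : nat :=
  xget 0%N [set n : nat |
    (exists A : {fset M},
       [/\ ([set` A] `<=` Y)%classic, independent A & #|` A| = n]) /\
    (forall A : {fset M},
       ([set` A] `<=` Y)%classic -> independent A -> (#|` A| <= n)%N)]%classic.

Definition fcl (A : {fset M}) : set M := [set x | G (x |` A)%fset = G A]%classic.

Definition cl (Y : set M) : set M :=
  [set x | exists2 A : {fset M}, ([set` A] `<=` Y)%classic & fcl A x]%classic.

Definition closed_in (Y : set M) : Prop := cl Y = Y.

(* A finite collection [{E_1, ..., E_k}] is an indexed family; repetitions are
   harmless, since their contributions cancel in the alternating sum. *)
Definition Delta (k : nat) (E : 'I_k -> set M) : int :=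
  (\sum_(s : {set 'I_k} | s != finset.set0)
     (-1) ^+ #|s|.+1 * (sdim (\bigcap_(i in [set` s]) E i)%classic)%:Z)%R.

Definition flat : Prop :=
  forall (k : nat) (E : 'I_k -> set M),
    (forall i, closed_in (E i)) -> (forall i, fin_dimensional (E i)) ->
    ((sdim (\bigcup_i E i)%classic)%:Z <= Delta E)%R.

End Pregeometry.

Section SubPregeometry.
Variables (M : choiceType) (G : pregeometry M) (H : {fset M}).

Definition subpdim (A : {fset H}) : nat := G (val @` A).

Lemma subpdim0 : subpdim fset0 = 0%N.
Proof. by rewrite /subpdim imfset0 pdim0. Qed.

Lemma subpdim_mono (A : {fset H}) x : (subpdim A <= subpdim (x |` A))%N.
Proof. by rewrite /subpdim imfsetU1 pdim_mono. Qed.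

Lemma subpdim_incr (A : {fset H}) x : (subpdim (x |` A) <= (subpdim A).+1)%N.
Proof. by rewrite /subpdim imfsetU1 pdim_incr. Qed.

Lemma subpdim_submod (A B : {fset H}) :
  (subpdim (A `|` B) + subpdim (A `&` B) <= subpdim A + subpdim B)%N.
Proof.
rewrite /subpdim imfsetU imfsetI; first exact: pdim_submod.
by move=> x y _ _; apply: val_inj.
Qed.

Definition subpregeometry : pregeometry H :=
  Pregeometry subpdim0 subpdim_mono subpdim_incr subpdim_submod.

(* [H ⊑ G]; the set [E ∩ H], as a set of points of the substructure [H], is the
   preimage of [E] under the inclusion. *)
Definition sqsub : Prop :=
  forall (k : nat) (E : 'I_k -> set M),
    (forall i, closed_in G (E i)) -> (forall i, fin_dimensional G (E i)) ->
    (Delta subpregeometry (fun i => val @^-1` E i)%classic <= Delta G E)%R.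

End SubPregeometry.

Definition pregeometry_embedding (M N : choiceType)
    (G : pregeometry M) (H : pregeometry N) (f : M -> N) : Prop :=
  injective f /\ forall A : {fset M}, H (f @` A) = G A.

Definition pregeometry_isomorphic (M N : choiceType)
    (G : pregeometry M) (H : pregeometry N) : Prop :=
  exists2 f : M -> N, bijective f & forall A : {fset M}, H (f @` A) = G A.

Record hypergraph (M : choiceType) := Hypergraph {
  edge : {pred {fset M}};
  edge_neq0 : forall e, e \in edge -> e != fset0 }.

Section Hypergraph.
Variables (M : choiceType) (A : hypergraph M).

Definition edges_in (P : {fset M}) : {fset {fset M}} :=
  [fset e in fpowerset P | e \in edge A].

Definition delta (Y : {fset M}) : int := (#|` Y|%:Z - #|` edges_in Y|%:Z)%R.

(* The infimum over finite [Y ⊇ X], as a minimum; the junk value 0 is taken only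
   when the values [delta Y] are unbounded below. *)
Definition hdim (X : {fset M}) : int :=
  xget (0%R : int) [set z : int |
    (exists2 Y : {fset M}, (X `<=` Y)%fset & delta Y = z) /\
    (forall Y : {fset M}, (X `<=` Y)%fset -> (z <= delta Y)%R)]%classic.

Definition delta_over (X P : {fset M}) : int :=
  (#|` X `\` P|%:Z - #|` edges_in (X `|` P) `\` edges_in P|%:Z)%R.

Definition hstrong (P : {fset M}) : Prop :=
  forall X : {fset M}, (0 <= delta_over X P)%R.

Lemma edges_inP (P e : {fset M}) :
  (e \in edges_in P) = (e `<=` P) && (e \in edge A).
Proof. by rewrite !inE /= fpowersetE. Qed.

Lemma edges_in0 : edges_in fset0 = fset0.
Proof.
apply/fsetP => e; rewrite edges_inP inE fsubset0.
by apply/negP => /andP[/eqP-> /edge_neq0]; rewrite eqxx.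
Qed.

Lemma delta_over0 X : delta_over X fset0 = delta X.
Proof. by rewrite /delta_over /delta edges_in0 !fsetD0 fsetU0. Qed.

Lemma delta_submod (Y Z : {fset M}) :
  (delta (Y `|` Z) + delta (Y `&` Z) <= delta Y + delta Z)%R.
Proof.
have hI : edges_in (Y `&` Z) = edges_in Y `&` edges_in Z.
  apply/fsetP => e; rewrite in_fsetI !edges_inP fsubsetI.
  by case: (e \in edge A); rewrite ?andbF ?andbT.
have hU : (#|` edges_in Y `|` edges_in Z| <= #|` edges_in (Y `|` Z)|)%N.
  apply: fsubset_leq_card; apply/fsubsetP => e; rewrite in_fsetU !edges_inP.
  case/orP => /andP[h ->]; rewrite andbT; apply: (fsubset_trans h).
    exact: fsubsetUl.
  exact: fsubsetUr.
have h1 := cardfsUI Y Z; have h2 := cardfsUI (edges_in Y) (edges_in Z).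
rewrite /delta hI !(addrACA _ (- _)%R) -!opprD -!PoszD h1 lerD2l lerN2 lez_nat.
by rewrite -h2 leq_add2r.
Qed.

Hypothesis A_strong0 : hstrong fset0.

Lemma delta_ge0 Y : (0 <= delta Y)%R.
Proof. by rewrite -delta_over0; exact: A_strong0. Qed.

Lemma hdim_spec (X : {fset M}) :
  (exists2 Y : {fset M}, X `<=` Y & delta Y = hdim X) /\
  (forall Y : {fset M}, X `<=` Y -> (hdim X <= delta Y)%R).
Proof.
rewrite /hdim; set P := (X in xget _ X).
suff [z Pz] : exists z, P z by exact: (xgetPex (0%R : int) (ex_intro P z Pz)).
pose Q n := `[< exists2 Y : {fset M}, X `<=` Y & delta Y = Posz n >].
have exQ : exists n, Q n.
  exists `|delta X|%N; apply/asboolP; exists X => //.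
  by rewrite gez0_abs // delta_ge0.
case: (ex_minnP exQ) => n /asboolP Qn minn; exists (Posz n); split=> // Y XY.
rewrite -(gez0_abs (delta_ge0 Y)) lez_nat; apply: minn; apply/asboolP.
by exists Y => //; rewrite gez0_abs // delta_ge0.
Qed.

Lemma hdim_ge0 X : (0 <= hdim X)%R.
Proof. by have [[Y _ <-] _] := hdim_spec X; exact: delta_ge0. Qed.

Definition hpdim (X : {fset M}) : nat := `|hdim X|%N.

Lemma hpdimE X : Posz (hpdim X) = hdim X.
Proof. by rewrite /hpdim gez0_abs // hdim_ge0. Qed.

Lemma hpdim0 : hpdim fset0 = 0%N.
Proof.
apply/eqP; rewrite -leqn0 -lez_nat hpdimE.
have [_ /(_ fset0 (fsubset_refl _))] := hdim_spec fset0.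
by rewrite /delta edges_in0 cardfs0 subr0.
Qed.

Lemma hpdim_mono (X : {fset M}) x : (hpdim X <= hpdim (x |` X))%N.
Proof.
rewrite -lez_nat !hpdimE; have [[Y hY <-] _] := hdim_spec (x |` X).
by have [_] := hdim_spec X; apply; apply: fsubset_trans hY; exact: fsubsetU1.
Qed.

Lemma hpdim_incr (X : {fset M}) x : (hpdim (x |` X) <= (hpdim X).+1)%N.
Proof.
rewrite -lez_nat -addn1 PoszD !hpdimE; have [[Y hY <-] _] := hdim_spec X.
have [_ /(_ (x |` Y) (fsetUS _ hY)) h] := hdim_spec (x |` X).
apply: (le_trans h); rewrite /delta addrAC -PoszD; apply: lerB; rewrite lez_nat.
  by rewrite cardfsU1 addnC leq_add2l leq_b1.
apply: fsubset_leq_card; apply/fsubsetP => e; rewrite !edges_inP.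
by case/andP => h1 ->; rewrite andbT (fsubset_trans h1) // fsubsetU1.
Qed.

Lemma hpdim_submod (X Z : {fset M}) :
  (hpdim (X `|` Z) + hpdim (X `&` Z) <= hpdim X + hpdim Z)%N.
Proof.
rewrite -lez_nat !PoszD !hpdimE.
have [[Y hY <-] _] := hdim_spec X; have [[W hW <-] _] := hdim_spec Z.
apply: le_trans (delta_submod Y W); apply: lerD.
  by have [_] := hdim_spec (X `|` Z); apply; exact: fsetUSS.
by have [_] := hdim_spec (X `&` Z); apply; exact: fsetISS.
Qed.

Definition hpregeometry : pregeometry M :=
  Pregeometry hpdim0 hpdim_mono hpdim_incr hpdim_submod.

End Hypergraph.

Section SubHypergraph.
Variables (M : choiceType) (A : hypergraph M) (P : {fset M}).

Definition subedge : {pred {fset P}} := [pred e | (val @` e : {fset M}) \in edge A].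

Lemma subedge_neq0 e : e \in subedge -> e != fset0.
Proof.
rewrite inE => /edge_neq0; apply: contra_neq => ->; exact: imfset0.
Qed.

Definition subhypergraph : hypergraph P := Hypergraph subedge_neq0.

End SubHypergraph.

Definition hypergraph_embedding (M N : choiceType)
    (A : hypergraph M) (B : hypergraph N) (f : M -> N) : Prop :=
  injective f /\ forall e : {fset M}, (f @` e \in edge B) = (e \in edge A).

(* [St] is a kind of structures on a carrier, [emb] its embeddings, [sub] its
   induced substructures on finite sets, [strong] the distinguished substructure
   relation "finite subset of a structure", and [C] a class of finite
   structures.  In the third clause the extension [B] of the finite strong
   substructure on [A] is presented by an embedding [g : A -> B] with strong
   image. *)
Definition is_generic (St : choiceType -> Type)
    (emb : forall M N : choiceType, St M -> St N -> (M -> N) -> Prop)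
    (sub : forall M : choiceType, St M -> forall A : {fset M}, St A)
    (strong : forall M : choiceType, St M -> {fset M} -> Prop)
    (C : forall U : finType, St U -> Prop)
    (T : countType) (S : St T) : Prop :=
  [/\ forall A : {fset T}, strong T S A -> C A (sub T S A),
      forall (U : finType) (B : St U), C U B ->
        exists2 f : U -> T, emb U T B S f & strong T S [fset f u | u : U],
      forall A : {fset T}, strong T S A ->
        forall (U : finType) (B : St U), C U B ->
        forall g : A -> U, emb A U (sub T S A) B g ->
          strong U B [fset g a | a : A] ->
        exists f : U -> T,
          [/\ emb U T B S f, forall a : A, f (g a) = val a
            & strong T S [fset f u | u : U]]
    & forall X : {fset T}, exists2 A : {fset T}, X `<=` A & strong T S A].

Definition generic_hypergraph (T : countType) (M : hypergraph T) : Prop :=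
  is_generic hypergraph_embedding subhypergraph hstrong
    (fun (U : finType) (B : hypergraph U) => hstrong B fset0) M.

Definition generic_flat_pregeometry (T : countType) (G : pregeometry T) : Prop :=
  is_generic pregeometry_embedding subpregeometry sqsub
    (fun (U : finType) (B : pregeometry U) => flat B) G.

Lemma generic_hypergraph_strong0 (T : countType) (M : hypergraph T) :
  generic_hypergraph M -> hstrong M fset0.
Proof.
case=> subC _ _ cover X; rewrite delta_over0.
have [A XA sA] := cover X.
pose X' : {fset A} := [fset a : A | val a \in X].
have valX' : val @` X' = X.
  apply/fsetP => x; apply/imfsetP/idP => [[a /=]|xX]; first by rewrite !inE => ? ->.
  by exists [` fsubsetP XA x xX] => //=; rewrite !inE.
have vinj : injective (val : A -> T) by exact: val_inj.
have iinj : injective (fun e : {fset A} => (val @` e : {fset T})).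
  move=> e1 e2 /fsetP h; apply/fsetP => a.
  by have := h (val a); rewrite !mem_imfset.
suff E : (fun e : {fset A} => val @` e : {fset T}) @`
    edges_in (subhypergraph M A) X' = edges_in M X.
  have := delta_ge0 (subC _ sA) X'.
  by rewrite /delta -E -[in X in (_ -> X)%type]valX' !card_imfset.
apply/fsetP => e; apply/imfsetP/idP => /=.
  case=> e'; rewrite !edges_inP => /andP[s h ->]; apply/andP; split=> //.
  by rewrite -valX'; apply: subset_imfset; apply/fsubsetP.
rewrite edges_inP => /andP[s h].
have eA : e `<=` A by exact: fsubset_trans XA.
have E : val @` [fset a : A | val a \in e] = e.
  apply/fsetP => x; apply/imfsetP/idP => [[a /=]|xe]; first by rewrite !inE => ? ->.
  by exists [` fsubsetP eA x xe] => //=; rewrite !inE.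
exists [fset a : A | val a \in e] => //; rewrite edges_inP inE E h andbT.
by apply/fsubsetP => a; rewrite !inE => /(fsubsetP s).
Qed.

(* Main.v *)
Require Import Defs.
From mathcomp Require Import all_boot all_order all_algebra finmap.
From mathcomp Require Import boolp classical_sets.
From mathcomp Require Import zify.

Set Implicit Arguments.
Unset Strict Implicit.
Unset Printing Implicit Defensive.

Import Order.TTheory GRing.Theory Num.Theory.

Local Open Scope fset_scope.

(** The isomorphism is built by back and forth.  The finite approximations are
    dimension-preserving bijections between a finite [A <= M] and a finite
    [A' ⊑ G] (predicate [strong_iso]), where [<=] is [hstrong] and [⊑] is
    [sqsub].

    Forth ([extend_left]).  A point [x] of [M] lies with [A] in some finite
    [N <= M].  If [N] is a finite hypergraph, the flats (closed sets) of [G_N] satisfy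
    [d = delta], so by inclusion-exclusion [Delta(E_1, ..., E_k)] is the number
    of points of [∪ E_i] minus the number of edges contained in some [E_i].
    Comparing this with [delta (∪ E_i)] shows that [G_N] is flat
    ([hpregeometry_flat]), and comparing it with the same count inside [A] shows
    that [A <= N] implies [G_A ⊑ G_N] ([hstrong_sqsub]).  Genericity of [G] then
    provides the extension.

    Back ([extend_right]).  A point [y] of [G] lies with [A'] in some finite
    [D ⊑ G], and then also [A' ⊑ D] ([sqsub_restrict]): the relation [D ⊑ G],
    applied to pairs of flats, says that closure in [G] commutes with
    intersections of flats of [D], so that [Delta] of flats of [D] can be
    computed in [G].  It remains to enlarge the hypergraph [A] to one on [D]
    whose pregeometry is [D] and in which [A] is strong; genericity of [M] then
    provides the extension.

    This enlargement ([realisation]) is the heart of the proof.  The number of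
    edges that span a flat [F] in a hypergraph with pregeometry [D] is forced:
    it is Mason's invariant [alpha F], the Moebius inverse of the nullity
    [|F| - d(F)] on the lattice of flats.  So [gamma F = alpha F - beta F] new
    edges are needed, where [beta F] edges of [A] span [F] already.  Flatness of
    [D] bounds the sums of [alpha], and [A' ⊑ D] bounds the sums of [gamma], over
    families of flats closed downwards ([sum_alpha_le_nullity],
    [sum_gamma_le_card]).  These bounds give [gamma >= 0], and they show that
    taking each [F] as an edge [gamma F] times defines the right dimension
    ([sum_gamma_le_nullity]).  Finally, repeated edges are removed: of two copies
    of [S] one can be replaced by [S] minus a point without changing the
    dimension ([realises_shrink]). *)

(** * Dimension and closure in a pregeometry *)

Section PregeometryDim.
Variables (M : choiceType) (G : pregeometry M).
Implicit Types A B : {fset M}.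

Lemma pdimS A B : A `<=` B -> (G A <= G B)%N.
Proof.
move=> /fsetUidPr <-; elim/fset1U_rect: B => [|x B _ IH]; first by rewrite fsetU0.
by rewrite fsetUCA; apply: leq_trans IH (pdim_mono _ _ _).
Qed.

Lemma pdim_le_card A B : (G B <= G A + #|` B `\` A|)%N.
Proof.
have: (G ((B `\` A) `|` A) <= G A + #|` B `\` A|)%N.
  elim/fset1U_rect: (B `\` A) => [|x C xC IH]; first by rewrite fset0U cardfs0 addn0.
  rewrite -fsetUA cardfsU1 xC addnCA; apply: leq_trans (pdim_incr _ _ _) _.
  by rewrite add1n ltnS.
apply: leq_trans; apply: pdimS; apply/fsubsetP => x xB.
by rewrite !inE xB andbT orNb.
Qed.

(** Submodularity says that the gain in dimension from adding [x] decreases as the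
    set grows. *)
Lemma span_mono x A B : A `<=` B -> G (x |` A) = G A -> G (x |` B) = G B.
Proof.
move=> AB xA; apply/eqP; rewrite eqn_leq pdim_mono andbT.
have := pdim_submod G (x |` A) B; rewrite xA -fsetUA (fsetUidPr _ _ AB) => h.
have : (G A <= G ((x |` A) `&` B))%N.
  by apply: pdimS; rewrite fsubsetI AB fsubsetU1.
lia.
Qed.

Lemma pdim_span A B : (forall y, y \in B -> G (y |` A) = G A) -> G (B `|` A) = G A.
Proof.
elim/fset1U_rect: B => [|x B _ IH] h; first by rewrite fset0U.
rewrite -fsetUA (@span_mono x A) ?fsubsetUr ?IH // => [y yB|].
  by apply: h; rewrite !inE yB orbT.
by apply: h; rewrite fset1U1.
Qed.

Lemma pdim_basis A : exists B, [/\ B `<=` A, independent G B & G B = G A].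
Proof.
elim/fset1U_rect: A => [|x A xA [B [BA iB GB]]].
  by exists fset0; split; rewrite // /independent pdim0 cardfs0.
have := pdim_incr G A x; rewrite leq_eqVlt ltnS => /orP[/eqP GxA|GxA]; last first.
  exists B; split=> //; first exact: fsubset_trans (fsubsetU1 _ _).
  by apply/eqP; rewrite GB eqn_leq pdim_mono.
have xB : x \notin B by apply: contra xA; apply/fsubsetP.
have GxB : G (x |` B) = (G B).+1.
  apply/eqP; rewrite eqn_leq pdim_incr /= ltn_neqAle pdim_mono andbT.
  by apply/eqP => /esym/(span_mono BA); rewrite GxA; lia.
exists (x |` B); split; first exact: fsetUS.
  by rewrite /independent GxB cardfsU1 xB iB.
by rewrite GxB GxA GB.
Qed.

Implicit Types Y Z : set M.

Definition spans B Y := forall y, Y y -> G (y |` B) = G B.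

Lemma spans_dim_le B Y A : spans B Y -> ([set` A] `<=` Y)%classic -> (G A <= G B)%N.
Proof.
move=> sB AY; rewrite -(@pdim_span B A) ?pdimS ?fsubsetUl // => y yA.
exact/sB/AY.
Qed.

(** Removes the choice operator from [sdim] once the supremum is known to be attained. *)
Lemma sdim_unique Y n :
    (exists A : {fset M},
       [/\ ([set` A] `<=` Y)%classic, independent G A & #|` A| = n]) ->
    (forall A : {fset M},
       ([set` A] `<=` Y)%classic -> independent G A -> (#|` A| <= n)%N) ->
  sdim G Y = n.
Proof.
move=> [A [AY iA An]] maxA; rewrite /sdim; case: xgetP => [m -> [[B [BY iB Bm]] maxB]|nex].
  by apply/eqP; rewrite eqn_leq -{1}Bm -{2}An maxA // maxB.
by exfalso; apply: (nex n); split=> //; exists A.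
Qed.

Lemma sdim_spans B Y : ([set` B] `<=` Y)%classic -> spans B Y -> sdim G Y = G B.
Proof.
move=> BY sB; apply: sdim_unique => [|A AY <-]; last exact: spans_dim_le AY.
have [A [AB iA GA]] := pdim_basis B; exists A; rewrite -GA; split=> //.
by move=> x /= xA; apply/BY/(fsubsetP AB).
Qed.

Lemma fin_dim_spans B Y : spans B Y -> fin_dimensional G Y.
Proof. by move=> sB; exists (G B) => A AY <-; apply: spans_dim_le AY. Qed.

(** An independent subset of [Y] of the largest possible size spans [Y]. *)
Lemma fin_dim_basis Y : fin_dimensional G Y ->
  exists2 B, ([set` B] `<=` Y)%classic & spans B Y.
Proof.
case=> n; elim: n => [|n IH] h.
  exists fset0 => // y Yy; apply/eqP; rewrite eqn_leq pdim_mono andbT pdim0 leqNgt.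
  apply/negP => Gy; suff : (#|` y |` fset0| <= 0)%N by rewrite cardfsU1 in_fset0.
  apply: h => [x /=|]; first by rewrite !inE orbF => /eqP->.
  have := pdim_incr G fset0 y; rewrite /independent cardfsU1 in_fset0 cardfs0 pdim0; lia.
have [[A [AY iA An]]|nA] := EM (exists A : {fset M},
    [/\ ([set` A] `<=` Y)%classic, independent G A & #|` A| = n.+1]); last first.
  apply: IH => A AY iA; have := h A AY iA; rewrite leq_eqVlt => /orP[/eqP An|//].
  by case: nA; exists A.
exists A => // y Yy; apply/eqP; rewrite eqn_leq pdim_mono andbT leqNgt.
apply/negP => lt; have yA : y \notin A.
  by apply/negP => yA; move: lt; rewrite mem_fset1U // ltnn.
suff : (#|` y |` A| <= n.+1)%N by rewrite cardfsU1 yA An ltnn.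
apply: h => [x /=|]; first by rewrite !inE => /orP[/eqP->//|]; apply: AY.
by have := pdim_incr G A y; rewrite /independent cardfsU1 yA; move: iA; rewrite /independent; lia.
Qed.

Lemma fin_dimS Y Z : (Y `<=` Z)%classic -> fin_dimensional G Z -> fin_dimensional G Y.
Proof. by move=> YZ [n h]; exists n => A AY; apply: h; apply: subset_trans YZ. Qed.

Lemma closed_spans Y B y : closed_in G Y -> ([set` B] `<=` Y)%classic ->
  G (y |` B) = G B -> Y y.
Proof. by move=> clY BY GyB; rewrite -clY; exists B. Qed.

Lemma closed_inP Y : (forall B y, ([set` B] `<=` Y)%classic -> G (y |` B) = G B -> Y y)
  -> closed_in G Y.
Proof.
move=> h; apply/seteqP; split=> [y [B BY]|y Yy]; first exact: h BY.
exists [fset y] => [x /=|]; first by rewrite inE => /eqP->.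
by rewrite /fcl /= fsetUid.
Qed.

Lemma closed_fcl B : closed_in G (fcl G B).
Proof.
apply: closed_inP => C y CB yC; rewrite /fcl /=.
have GC : G (C `|` B) = G B by apply: pdim_span => z /CB.
apply/eqP; rewrite eqn_leq pdim_mono andbT -GC.
rewrite -(@span_mono y C (C `|` B)) ?fsubsetUl //; apply: pdimS.
by apply/fsetUS/fsubsetUr.
Qed.

Lemma fcl_sub B : ([set` B] `<=` fcl G B)%classic.
Proof. by move=> x /= xB; rewrite /fcl /= mem_fset1U. Qed.

Lemma spans_fcl B : spans B (fcl G B). Proof. by []. Qed.

Lemma sdim_fcl B : sdim G (fcl G B) = G B.
Proof. by apply: sdim_spans => //; apply: fcl_sub. Qed.

Lemma sdim_fset B : sdim G [set` B]%classic = G B.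
Proof. by apply: sdim_spans => // x /= xB; rewrite mem_fset1U. Qed.

Lemma closed_bigcap (I : Type) (P : set I) (F : I -> set M) :
  (forall i, P i -> closed_in G (F i)) -> closed_in G (\bigcap_(i in P) F i)%classic.
Proof.
move=> clF; apply: closed_inP => B y BF yB i Pi.
by apply: (closed_spans (clF i Pi) _ yB) => x /BF; apply.
Qed.

Lemma closed_setI Y Z : closed_in G Y -> closed_in G Z -> closed_in G (Y `&` Z)%classic.
Proof.
move=> cY cZ; apply: closed_inP => B y BYZ yB.
by split; [apply: closed_spans cY _ yB | apply: closed_spans cZ _ yB] => x /BYZ[].
Qed.

Lemma closed_eq_fcl B Y : closed_in G Y -> ([set` B] `<=` Y)%classic -> spans B Y ->
  Y = fcl G B.
Proof.
move=> clY BY sB; apply/seteqP; split=> [y /sB//|y yB].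
exact: closed_spans clY BY yB.
Qed.

Lemma spans_of_dim B Y : fin_dimensional G Y -> ([set` B] `<=` Y)%classic ->
  (sdim G Y <= G B)%N -> spans B Y.
Proof.
move=> /fin_dim_basis[C CY sC]; rewrite (sdim_spans CY sC) => BY CB y Yy.
apply/eqP; rewrite eqn_leq pdim_mono andbT; apply: leq_trans CB.
apply: (spans_dim_le sC) => x /=; rewrite !inE => /orP[/eqP->//|]; exact: BY.
Qed.

End PregeometryDim.

(** * Inclusion-exclusion *)

Section InclusionExclusion.
Local Open Scope ring_scope.
Variable k : nat.

(** [Delta G E] is by definition [altsum] of the dimensions of the intersections
    of the [E i].  Stated for an arbitrary function of the index set, the sum can
    also be applied to cardinals and to sums of weights. *)
Definition altsum (phi : {set 'I_k} -> int) : int :=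
  \sum_(s : {set 'I_k} | s != finset.set0) (-1) ^+ #|s|.+1 * phi s.

Lemma eq_altsum phi psi : (forall s : {set 'I_k}, s != finset.set0 -> phi s = psi s) ->
  altsum phi = altsum psi.
Proof. by move=> h; apply: eq_bigr => s /h->. Qed.

Lemma altsumB phi psi : altsum (fun s => phi s - psi s) = altsum phi - altsum psi.
Proof. by rewrite /altsum -sumrB; apply: eq_bigr => s _; rewrite mulrBr. Qed.

(** Adding or removing a fixed element of [J] is an involution on the subsets of
    [J] that reverses the sign. *)
Lemma sum_sign_subsets (J : {set 'I_k}) : J != finset.set0 ->
  \sum_(s : {set 'I_k} | s \subset J) (-1) ^+ #|s|.+1 = 0 :> int.
Proof.
case/finset.set0Pn => j jJ.
pose t (s : {set 'I_k}) := if j \in s then s :\ j else j |: s.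
have tK : involutive t.
  move=> s; rewrite /t; have [js|js] := boolP (j \in s); first by rewrite finset.setD11 finset.setD1K.
  by rewrite setU11 finset.setU1K.
set S := LHS; suff : S = - S by lia.
rewrite {1}/S (reindex_inj (inv_inj tK)) -sumrN /=; apply: eq_big => s.
  rewrite /t; case: ifP => js; rewrite ?finset.subUset ?finset.sub1set ?jJ //.
  apply/idP/idP => [h|]; last by apply: fintype.subset_trans; exact: finset.subD1set.
  by rewrite -(finset.setD1K js) finset.subUset finset.sub1set jJ.
move=> _; rewrite /t; have [js|js] := boolP (j \in s).
  by rewrite [in RHS](cardsD1 j) js add1n [in RHS]exprS mulN1r opprK.
by rewrite cardsU1 js add1n exprS mulN1r.
Qed.

Lemma sum_sign_nonempty (J : {set 'I_k}) :
  \sum_(s : {set 'I_k} | (s != finset.set0) && (s \subset J)) (-1) ^+ #|s|.+1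
   = (J != finset.set0)%:R :> int.
Proof.
have [->|J0] := eqVneq J finset.set0.
  by apply: big1 => s /andP[s0]; rewrite finset.subset0 (negbTE s0).
have := sum_sign_subsets J0.
rewrite (bigD1 finset.set0) ?finset.sub0set //= cards0 => /eqP.
under eq_bigl do rewrite andbC.
by rewrite addrC addr_eq0 => /eqP->; rewrite expr1 opprK.
Qed.

(** Inclusion-exclusion for weighted elements: after exchanging the sums, each [x]
    contributes [w x] times the signed number of the nonempty subsets of
    [{i | P i x}]. *)
Lemma altsum_sum (I : Type) (r : seq I) (P : 'I_k -> pred I) (w : I -> int) :
  altsum (fun s => \sum_(x <- r | [forall i in s, P i x]) w x)
  = \sum_(x <- r | [exists i, P i x]) w x.
Proof.
rewrite /altsum; under eq_bigr do rewrite big_distrr /= big_mkcond.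
rewrite exchange_big /= [RHS]big_mkcond; apply: eq_bigr => x _.
pose J := [set i | P i x]%SET.
transitivity (\sum_(s : {set 'I_k} | (s != finset.set0) && (s \subset J)) (-1) ^+ #|s|.+1 * w x).
  rewrite big_mkcondr /=; apply: eq_bigr => s _; congr (if _ then _ else _).
  by apply/forall_inP/fintype.subsetP => h i /h; rewrite inE.
rewrite -big_distrl /= sum_sign_nonempty.
have -> : [exists i, P i x] = (J != finset.set0).
  by apply/existsP/finset.set0Pn => -[i]; exists i; move: p; rewrite ?inE.
by case: (J != _); rewrite ?mul1r ?mul0r.
Qed.

End InclusionExclusion.

(** Only the [Delta] of two closed sets has to be written out; it measures the
    failure of modularity of the pair. *)
Lemma altsum2 (phi : {set 'I_2} -> int) :
  altsum phi = (phi [set ord0]%SET + phi [set ord_max]%SET - phi finset.setT)%R.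
Proof.
have ne0 (i : 'I_2) : [set i]%SET != finset.set0 :> {set 'I_2}.
  by apply/finset.set0Pn; exists i; rewrite inE.
have T0 : finset.setT != finset.set0 :> {set 'I_2}.
  by apply/finset.set0Pn; exists ord0; rewrite inE.
have T1 (i : 'I_2) : finset.setT != [set i]%SET :> {set 'I_2}.
  by apply/eqP => /(congr1 (fun s : {set _} => #|s|)); rewrite cardsT card_ord cards1.
rewrite /altsum (bigD1 finset.setT) //= (bigD1 [set ord0]%SET) /=; last first.
  by rewrite ne0 eq_sym T1.
rewrite (bigD1 [set ord_max]%SET) /=; last first.
  rewrite ne0 eq_sym T1 /=; apply/eqP => /setP /(_ ord0).
  by rewrite !inE.
have ext (s t : {set 'I_2}) :
    (ord0 \in s) = (ord0 \in t) -> (ord_max \in s) = (ord_max \in t) -> s = t.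
  move=> h0 h1; apply/setP => i; have [->//|i0] := eqVneq i ord0.
  by rewrite (_ : i = ord_max) //; apply: val_inj; case: i i0 => -[|[|]].
rewrite big1 => [|s /andP[/andP[/andP[s0 sT] s1] s2]].
  rewrite !cards1 cardsT card_ord addr0 !exprS expr0; lia.
exfalso; move: s0 sT s1 s2; have [os|os] := boolP (ord0 \in s);
  have [ms|ms] := boolP (ord_max \in s).
- by rewrite (_ : s = finset.setT) ?eqxx ?andbF //; apply: ext; rewrite inE ?os ?ms.
- by rewrite (_ : s = [set ord0]%SET) ?eqxx // => *; apply: ext; rewrite inE ?os ?(negbTE ms).
- by rewrite (_ : s = [set ord_max]%SET) ?eqxx //; apply: ext; rewrite inE ?(negbTE os) ?ms.
- by rewrite (_ : s = finset.set0) ?eqxx //; apply: ext; rewrite inE ?(negbTE os) ?(negbTE ms).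
Qed.

(** * Substructures of flat pregeometries *)

Definition fset_of (D : finType) (P : set D) : {fset D} := [fset x : D | `[< P x >]].

Lemma in_fset_of (D : finType) (P : set D) x : (x \in fset_of P) = `[< P x >].
Proof. by rewrite !inE. Qed.

Lemma in_fset_cond (X : choiceType) (S : {fset X}) (P : pred X) x :
  (x \in [fset y in S | P y]) = (x \in S) && P x.
Proof. by rewrite !inE. Qed.

Section Substructures.
Variables (M : choiceType) (G : pregeometry M).

Definition trace (H : {fset M}) (Y : set M) : {fset M} := [fset x in H | `[< Y x >]].

Lemma in_trace H Y x : (x \in trace H Y) = (x \in H) && `[< Y x >].
Proof. by rewrite !inE. Qed.

Lemma sdim_sub (H : {fset M}) (Y : set M) :
  sdim (subpregeometry G H) (val @^-1` Y)%classic = G (trace H Y).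
Proof.
pose B := fset_of (val @^-1` Y : set H)%classic.
have -> : trace H Y = val @` B.
  apply/fsetP => x; rewrite in_trace; apply/andP/imfsetP => /= [[xH xY]|[y]].
    by exists [` xH] => //; rewrite in_fset_of.
  by rewrite in_fset_of => yY ->; split=> //; exact: valP.
rewrite (@sdim_spans _ (subpregeometry G H) B) // => [x /=|y /= Yy].
  by rewrite in_fset_of => /asboolP.
by rewrite mem_fset1U // in_fset_of; apply/asboolP.
Qed.

(** The relation expressed without the dimension function of the substructure, so
    that the two sides live on the same type. *)
Lemma sqsubP (H : {fset M}) : sqsub G H <-> forall (k : nat) (E : 'I_k -> set M),
    (forall i, closed_in G (E i)) -> (forall i, fin_dimensional G (E i)) ->
  (altsum (fun s => Posz (G (trace H (\bigcap_(i in [set` s]) E i)%classic)))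
   <= altsum (fun s => Posz (sdim G (\bigcap_(i in [set` s]) E i)%classic)))%R.
Proof.
have D (k : nat) (E : 'I_k -> set M) :
    Delta (subpregeometry G H) (fun i => val @^-1` E i)%classic
  = altsum (fun s => Posz (G (trace H (\bigcap_(i in [set` s]) E i)%classic))).
  apply: eq_bigr => s _; rewrite -preimage_bigcap; congr (_ * Posz _)%R.
  exact: sdim_sub.
by split=> h k E cE fE; have := h k E cE fE; rewrite D.
Qed.

End Substructures.

Section Restriction.
Variables (M : choiceType) (G : pregeometry M) (A D : {fset M}).
Hypotheses (AD : A `<=` D) (hD : sqsub G D) (hA : sqsub G A).
Implicit Type Z : set D.

Let GD := subpregeometry G D.

Definition lift Z : {fset M} := val @` fset_of Z.

Lemma liftP Z x : reflect (exists2 y : D, Z y & x = val y) (x \in lift Z).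
Proof.
apply: (iffP (imfsetP _ _ _ _)) => /= -[y].
  by rewrite in_fset_of => /asboolP; exists y.
by move=> Zy ->; exists y; rewrite //= in_fset_of; apply/asboolP.
Qed.

Lemma sdim_lift Z : sdim GD Z = G (lift Z).
Proof.
rewrite -[RHS](sdim_fset GD (fset_of Z)); congr (sdim _ _).
by apply/seteqP; split=> y /=; rewrite in_fset_of => /asboolP.
Qed.

Lemma fcl_liftE Z : closed_in GD Z -> (val @^-1` fcl G (lift Z) = Z)%classic.
Proof.
move=> cZ; apply/seteqP; split=> y /= yZ; last first.
  by apply/fcl_sub/liftP; exists y.
apply: (@closed_spans _ _ _ (fset_of Z) _ cZ).
  by move=> x /=; rewrite in_fset_of => /asboolP.
by rewrite /GD /= /subpdim imfsetU1.
Qed.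

Lemma lift_trace Z : closed_in GD Z -> lift Z = trace D (fcl G (lift Z)).
Proof.
move=> cZ; apply/fsetP => x; rewrite in_trace; apply/liftP/andP => [[y Zy ->]|[xD /asboolP Zx]].
  by split; [exact: valP | apply/asboolP/fcl_sub/liftP; exists y].
by exists [` xD] => //; rewrite -(fcl_liftE cZ).
Qed.

(** The relation [D ⊑ G] for two closed sets compares
    [d(F1) + d(F2) - d(F1 ∩ F2)] computed in [D] and in [G].  The first two terms
    agree for closures of flats of [D], hence the intersection of the closures has
    no larger dimension than the intersection of the flats; as it contains the
    closure of the latter, the two are equal. *)
Lemma fcl_liftI Z1 Z2 : closed_in GD Z1 -> closed_in GD Z2 ->
  (fcl G (lift Z1) `&` fcl G (lift Z2) = fcl G (lift (Z1 `&` Z2)))%classic.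
Proof.
move=> c1 c2; pose F (i : 'I_2) := fcl G (lift (if i == ord0 then Z1 else Z2)).
have F12 : (\bigcap_(i in [set` finset.setT]) F i = fcl G (lift Z1) `&` fcl G (lift Z2))%classic.
  apply/seteqP; split=> x.
    by move=> h; split; [apply: (h ord0) | apply: (h ord_max)]; rewrite /= inE.
  by move=> [x1 x2] i _; rewrite /F; case: ifP.
have c12 : closed_in GD (Z1 `&` Z2)%classic by apply: closed_setI.
have F1 (i : 'I_2) : (\bigcap_(j in [set` [set i]%SET]) F j = F i)%classic.
  by rewrite -[RHS]bigcap_set1; apply: eq_bigcapl; split=> j /=; rewrite inE => /eqP.
have /sqsubP/(_ 2 F) := hD; rewrite !altsum2 !F1 F12.
have -> : trace D (fcl G (lift Z1) `&` fcl G (lift Z2))%classic = lift (Z1 `&` Z2)%classic.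
  apply/fsetP => x; rewrite in_trace; apply/andP/liftP => [[xD /asboolP[x1 x2]]|[y [y1 y2] ->]].
    exists [` xD] => //; split; first by rewrite -(fcl_liftE c1).
    by rewrite -(fcl_liftE c2).
  split; first exact: valP.
  by apply/asboolP; split; apply/fcl_sub/liftP; exists y.
rewrite /F /= -!lift_trace // !sdim_fcl => h.
have {h}le : (sdim G (fcl G (lift Z1) `&` fcl G (lift Z2))%classic <= G (lift (Z1 `&` Z2)%classic))%N.
  rewrite -lez_nat.
  have := h (fun i => closed_fcl _ _) (fun i => fin_dim_spans (@spans_fcl _ _ _)).
  lia.
apply: closed_eq_fcl => //.
- by apply: closed_setI; apply: closed_fcl.
- by move=> x /= /liftP[y [y1 y2] ->]; split; apply/fcl_sub/liftP; exists y.
- apply: spans_of_dim => //.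
    by apply: fin_dimS (fin_dim_spans (@spans_fcl _ G (lift Z1))) => x [].
  by move=> x /= /liftP[y [y1 y2] ->]; split; apply/fcl_sub/liftP; exists y.
Qed.

(** By induction from the case of two sets: the intersection of all but one of the
    closures is again the closure of a flat of [D]. *)
Lemma fcl_lift_bigcap (k : nat) (E : 'I_k -> set D) (s : {set 'I_k}) :
    (forall i, closed_in GD (E i)) -> s != finset.set0 ->
  (\bigcap_(i in [set` s]) fcl G (lift (E i))
   = fcl G (lift (\bigcap_(i in [set` s]) E i)))%classic.
Proof.
move=> cE; elim: {s}#|s| {-2}s (erefl #|s|) => [|n IH] s sn.
  by rewrite -cards_eq0 sn.
case/finset.set0Pn => j js; have {}sn : #|s :\ j| = n.
  by move: sn; rewrite (finset.cardsD1 j) js add1n => -[].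
have sE : [set` s]%classic = (j |` [set` s :\ j])%classic.
  apply/seteqP; split=> i /=; first by rewrite !inE => is_; case: (eqVneq i j) => [|ij]; [left|right].
  by case=> [->//|]; rewrite !inE => /andP[].
rewrite sE !bigcap_setU1; have [s0|s0] := eqVneq (s :\ j) finset.set0.
  rewrite s0 (_ : [set` finset.set0]%classic = set0%classic) ?bigcap_set0 ?setIT //.
  by apply/seteqP; split=> i /=; rewrite ?inE.
by rewrite IH // fcl_liftI //; apply: closed_bigcap.
Qed.

(** A flat [Z] of [D] has a closure in [G] with the same dimension and the same
    trace on [A]; as closure commutes with intersections, the inequality for [A]
    in [D] is the one for [A] in [G] applied to the closures. *)
Lemma sqsub_restrict : sqsub GD [fset a : D | val a \in A].
Proof.
have inA (y : D) : (y \in [fset a : D | val a \in A]) = (val y \in A) by rewrite !inE.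
move: [fset a : D | val a \in A] inA => A' inA.
apply/sqsubP => k E cE fE; pose F i := fcl G (lift (E i)).
have /sqsubP/(_ k F) := hA.
move=> /(_ (fun i => closed_fcl _ _) (fun i => fin_dim_spans (@spans_fcl _ _ _))) h.
move: h; congr (is_true (_ <= _)%R); apply: eq_altsum => s s0; congr Posz.
  rewrite /F fcl_lift_bigcap //; congr (G _); symmetry.
  have cs : closed_in GD (\bigcap_(i in [set` s]) E i)%classic by apply: closed_bigcap.
  apply/fsetP => x; apply/imfsetP/idP => /= [[y]|].
    rewrite !in_trace inA => /andP[yA /asboolP yE] ->.
    by rewrite yA; apply/asboolP/fcl_sub/liftP; exists y.
  rewrite in_trace => /andP[xA /asboolP xF].
  have xD := fsubsetP AD _ xA; exists [` xD] => //=.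
  by rewrite in_trace inA xA; apply/asboolP; rewrite -(fcl_liftE cs).
by rewrite /F fcl_lift_bigcap // sdim_fcl sdim_lift.
Qed.

End Restriction.

(** * The pregeometry of a hypergraph *)

Section HypergraphDim.
Variables (M : choiceType) (N : hypergraph M).
Implicit Types P Q X Y Z : {fset M}.
Local Open Scope ring_scope.

Lemma edges_inS X Y : X `<=` Y -> edges_in N X `<=` edges_in N Y.
Proof.
move=> XY; apply/fsubsetP => e; rewrite !edges_inP => /andP[eX ->].
by rewrite (fsubset_trans eX).
Qed.

Lemma delta_overE X P : delta_over N X P = delta N (X `|` P) - delta N P.
Proof.
rewrite /delta_over /delta.
have := cardfsID (edges_in N P) (edges_in N (X `|` P)).
rewrite (fsetIidPr (edges_inS (fsubsetUr X P))).
have : #|` X `|` P| = (#|` P| + #|` X `\` P|)%N.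
  have := cardfsID P (X `|` P); rewrite fsetUK fsetDUl fsetDv fsetU0; lia.
lia.
Qed.

(** The relative predimension is a difference of predimensions, so [P] is strong
    exactly when it minimises [delta] among its finite supersets. *)
Lemma hstrongP P : hstrong N P <-> forall Y, P `<=` Y -> delta N P <= delta N Y.
Proof.
split=> h X; last by rewrite delta_overE subr_ge0 h ?fsubsetUr.
by move=> PX; have := h X; rewrite delta_overE subr_ge0 (fsetUidPl _ _ PX).
Qed.

(** Submodularity, together with [delta P <= delta (P ∪ Z)]. *)
Lemma delta_capr P Z : hstrong N P -> delta N (P `&` Z) <= delta N Z.
Proof.
move=> /hstrongP/(_ (P `|` Z) (fsubsetUl _ _)); have := delta_submod N P Z; lia.
Qed.

Lemma hstrongI P Q : hstrong N P -> hstrong N Q -> hstrong N (P `&` Q).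
Proof.
move=> hP hQ; apply/hstrongP => Y PQY.
apply: le_trans (delta_capr Y hQ); apply: le_trans (delta_capr (Q `&` Y) hP).
by rewrite fsetIA (fsetIidPl PQY).
Qed.

Hypothesis N0 : hstrong N fset0.
Let G := hpregeometry N0.

Lemma hpdim_le_delta X Y : X `<=` Y -> Posz (G X) <= delta N Y.
Proof. by move=> XY; rewrite hpdimE //; have [_] := hdim_spec N0 X; apply. Qed.

Lemma hpdim_attained X : exists2 Y, X `<=` Y & Posz (G X) = delta N Y.
Proof. by have [[Y XY YE] _] := hdim_spec N0 X; exists Y; rewrite // hpdimE. Qed.

Lemma hpdim_unique X (n : nat) : (forall Y, X `<=` Y -> Posz n <= delta N Y) ->
  (exists2 Y, X `<=` Y & delta N Y <= Posz n) -> G X = n.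
Proof.
move=> lb [Y XY Yn]; have := hpdim_le_delta XY.
have [Z XZ ZE] := hpdim_attained X; have := lb Z XZ; rewrite -ZE; lia.
Qed.

Lemma hpdim_strong P : hstrong N P -> Posz (G P) = delta N P.
Proof.
move=> /hstrongP hP; have := hpdim_le_delta (fsubset_refl P).
have [Y PY ->] := hpdim_attained P; have := hP Y PY; lia.
Qed.

(** A set that attains the dimension of [F] is contained in the closure of [F], so
    it is [F] itself when [F] is closed. *)
Lemma hstrong_closed F : (forall x, G (x |` F) = G F -> x \in F) -> hstrong N F.
Proof.
move=> cF; apply/hstrongP => Y FY; have [Z FZ ZE] := hpdim_attained F.
suff -> : F = Z by rewrite -{1}ZE; apply: hpdim_le_delta; rewrite // -ZE.
apply/eqP; rewrite eqEfsubset FZ; apply/fsubsetP => z zZ; apply: cF.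
have : Posz (G (z |` F)) <= delta N Z.
  by apply: hpdim_le_delta; rewrite fsubUset fsub1set zZ.
have := pdim_mono G F z; rewrite -ZE; lia.
Qed.

End HypergraphDim.

Lemma altsum_card (k : nat) (X : choiceType) (S : {fset X}) (P : 'I_k -> pred X) :
  altsum (fun s => Posz #|` [fset x in S | [forall i in s, P i x]]|)
  = Posz #|` [fset x in S | [exists i, P i x]]|.
Proof.
have E (Q : pred X) : Posz #|` [fset x in S | Q x]| = (\sum_(x <- S | Q x) 1)%R.
  by rewrite big_fset_condE big_const_seq count_predT iter_addr_0 natz.
rewrite E -(altsum_sum S P (fun=> 1%R)); apply: eq_altsum => s _; exact: E.
Qed.

Section FiniteHypergraph.
Variables (D : finType) (N : hypergraph D) (N0 : hstrong N fset0).
Let G := hpregeometry N0.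
Variables (k : nat) (E : 'I_k -> set D).
Hypothesis cE : forall i, closed_in G (E i).

Let U := fset_of (\bigcup_i E i)%classic.
Let RU (A : {fset D}) := [fset e in edges_in N A | [exists i, e `<=` fset_of (E i)]].

(** Flats are strong and intersections of strong sets are strong, so on all the
    traces the dimension is points minus edges; both parts are computed by
    inclusion-exclusion.  An edge lies in [∩ E_i] iff it lies in each [E_i]. *)
Lemma altsum_trace (A : {fset D}) : hstrong N A ->
  altsum (fun s => Posz (G (trace A (\bigcap_(i in [set` s]) E i)%classic)))
  = (Posz #|` A `&` U| - Posz #|` RU A|)%R.
Proof.
move=> hA.
have -> : A `&` U = [fset x in A | [exists i, x \in fset_of (E i)]].
  apply/fsetP => x; rewrite in_fsetI in_fset_of in_fset_cond; congr (_ && _).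
  apply/asboolP/existsP => [[i _ xi]|[i]]; first by exists i; rewrite in_fset_of; apply/asboolP.
  by rewrite in_fset_of => /asboolP; exists i.
rewrite /RU -!altsum_card -altsumB; apply: eq_altsum => s _.
set B := trace _ _.
have Bs : hstrong N B.
  have -> : B = A `&` fset_of (\bigcap_(i in [set` s]) E i)%classic.
    by apply/fsetP => x; rewrite in_trace in_fsetI in_fset_of.
  apply: hstrongI => //; apply: (hstrong_closed (N0 := N0)) => x.
  have cs : closed_in G (\bigcap_(i in [set` s]) E i)%classic by apply: closed_bigcap.
  move=> xG; rewrite in_fset_of; apply/asboolP.
  by apply: closed_spans cs _ xG => y /=; rewrite in_fset_of => /asboolP.
rewrite hpdim_strong // /delta.
congr (_ - _)%R; congr Posz; congr (size (enum_fset _)); apply/fsetP.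
  move=> x; rewrite in_trace in_fset_cond; congr (_ && _).
  apply/asboolP/forall_inP => [h i is_|h i /= is_]; first by rewrite in_fset_of; apply/asboolP/h.
  by have := h i is_; rewrite in_fset_of => /asboolP.
move=> e; rewrite in_fset_cond !edges_inP [RHS]andbAC; congr (_ && _).
apply/fsubsetP/andP => [h|[eA /forall_inP h] x xe].
  split; first by apply/fsubsetP => x /h; rewrite in_trace => /andP[].
  apply/forall_inP => i is_; apply/fsubsetP => x /h; rewrite in_trace => /andP[_ /asboolP xs].
  by rewrite in_fset_of; apply/asboolP/xs.
rewrite in_trace (fsubsetP eA) //; apply/asboolP => i /= is_.
by have := fsubsetP (h i is_) x xe; rewrite in_fset_of => /asboolP.
Qed.

End FiniteHypergraph.

Section FiniteHypergraphFlat.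
Variables (D : finType) (N : hypergraph D) (N0 : hstrong N fset0).
Let G := hpregeometry N0.

Lemma altsum_sdim (k : nat) (E : 'I_k -> set D) (T := fset_of (setT : set D)) :
    (forall i, closed_in G (E i)) ->
  altsum (fun s => Posz (sdim G (\bigcap_(i in [set` s]) E i)%classic))
  = (Posz #|` fset_of (\bigcup_i E i)%classic|
     - Posz #|` [fset e in edges_in N T | [exists i, e `<=` fset_of (E i)]]|)%R.
Proof.
move=> cE; have TX (X : {fset D}) : X `<=` T.
  by apply/fsubsetP => x _; rewrite in_fset_of; apply/asboolP.
have hT : hstrong N T.
  apply/hstrongP => Y TY; suff -> : Y = T by [].
  by apply/eqP; rewrite eqEfsubset TX TY.
rewrite -(fsetIidPr (TX (fset_of (\bigcup_i E i)%classic))) -(altsum_trace cE hT).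
apply: eq_altsum => s _; congr Posz; rewrite -sdim_fset; congr (sdim _ _).
apply/seteqP; split=> x /=; rewrite in_trace; last by case/andP => _ /asboolP.
by move=> xE; rewrite (fsubsetP (TX [fset x])) ?inE //; apply/asboolP.
Qed.

(** [Delta] counts points of the union minus edges inside some [E i], whereas
    [delta] of the union subtracts all edges inside the union. *)
Lemma hpregeometry_flat : flat G.
Proof.
move=> k E cE _; have := altsum_sdim cE; rewrite /altsum => h.
rewrite /Delta {}h; set U := fset_of _.
have -> : (\bigcup_i E i)%classic = [set` U]%classic.
  by apply/seteqP; split=> x /=; rewrite in_fset_of => /asboolP.
rewrite sdim_fset; apply: le_trans (hpdim_le_delta N0 (fsubset_refl U)) _.
rewrite /delta lerD2l lerN2 lez_nat; apply: fsubset_leq_card.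
apply/fsubsetP => e; rewrite in_fset_cond !edges_inP => /andP[/andP[_ ->] /existsP[i ei]].
rewrite andbT; apply: (fsubset_trans ei); apply/fsubsetP => x.
by rewrite !in_fset_of => /asboolP xi; apply/asboolP; exists i.
Qed.

(** The difference of the two sides is the number of points of [∪ E_i] outside [A]
    minus the number of edges inside some [E_i] that are not inside [A]; it is at
    least the relative predimension of [∪ E_i] over [A]. *)
Lemma hstrong_sqsub (A : {fset D}) : hstrong N A -> sqsub G A.
Proof.
move=> hA; apply/sqsubP => k E cE _; rewrite altsum_trace // altsum_sdim //.
set U := fset_of _; set RA := [fset e in _ | _]; set RT := [fset e in _ | _].
have := hA U; rewrite /delta_over.
have : (#|` RT `\` RA| <= #|` edges_in N (U `|` A) `\` edges_in N A|)%N.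
  apply: fsubset_leq_card; apply/fsubsetP => e; case/fsetDP => eT eA.
  move: eT eA; rewrite [e \in RT]in_fset_cond [e \in RA]in_fset_cond !edges_inP => + eA.
  case/andP => /andP[_ ee] eE; rewrite ee eE !andbT in eA.
  rewrite in_fsetD !edges_inP ee !andbT eA /=.
  case/existsP: eE => i ei; apply: (fsubset_trans ei); apply/fsubsetP => x.
  by rewrite in_fsetU !in_fset_of => /asboolP xi; apply/orP; left; apply/asboolP; exists i.
have : (#|` RT| <= #|` RT `\` RA| + #|` RA|)%N.
  rewrite -(cardfsID RA RT) addnC leq_add2l; apply: fsubset_leq_card; exact: fsubsetIr.
have := cardfsID A U; rewrite fsetIC; lia.
Qed.

End FiniteHypergraphFlat.
(** * Realising a flat extension by a hypergraph *)

Lemma fin_dim_fin (U : finType) (G : pregeometry U) (Y : set U) : fin_dimensional G Y.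
Proof.
apply: (@fin_dim_spans _ G (fset_of Y)) => y Yy; rewrite mem_fset1U // in_fset_of.
exact/asboolP.
Qed.

Lemma sdim_fin (U : finType) (G : pregeometry U) (Y : set U) : sdim G Y = G (fset_of Y).
Proof.
rewrite -sdim_fset; congr (sdim _ _).
by apply/seteqP; split=> x /=; rewrite in_fset_of => /asboolP.
Qed.

(** The carrier of a finite set occurs in several convertible forms, which [lia]
    takes for distinct terms; [set] abstracts the numbers up to conversion first. *)
Ltac card_lia := repeat match goal with
  | |- context [size (enum_fset ?X)] =>
      let c := fresh "c" in set c := (size (enum_fset X)); clearbody c
  | |- context [count ?p ?s] => let c := fresh "c" in set c := (count p s); clearbody c
  | |- context [pdim ?G ?X] => let c := fresh "c" in set c := (pdim G X); clearbody c
  end; lia.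

Section Realization.
Variables (D : finType) (G : pregeometry D).
Implicit Types (X Y F E : {fset D}) (Q : pred {fset D}).

Definition closure_of X := fset_of (fcl G X).
Definition closedb F := closure_of F == F.

Lemma in_closure_of X x : (x \in closure_of X) = (G (x |` X) == G X).
Proof. by rewrite in_fset_of; apply/asboolP/eqP. Qed.

Lemma sub_closure_of X : X `<=` closure_of X.
Proof. by apply/fsubsetP => x xX; rewrite in_closure_of mem_fset1U. Qed.

Lemma closure_ofS X Y : X `<=` Y -> closure_of X `<=` closure_of Y.
Proof.
by move=> XY; apply/fsubsetP => x; rewrite !in_closure_of => /eqP/(span_mono XY)->.
Qed.

Lemma pdim_closure_of X : G (closure_of X) = G X.
Proof.
rewrite -(@pdim_span _ G X (closure_of X)); last by move=> y; rewrite in_closure_of => /eqP.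
by rewrite (fsetUidPl _ _ (sub_closure_of X)).
Qed.

Lemma closedb_closure_of X : closedb (closure_of X).
Proof.
rewrite /closedb eqEfsubset sub_closure_of andbT; apply/fsubsetP => x.
rewrite !in_closure_of pdim_closure_of => /eqP h; rewrite eqn_leq pdim_mono andbT -h.
by apply/pdimS/fsetUS/sub_closure_of.
Qed.

Lemma closure_of_subE X F : closedb F -> (closure_of X `<=` F) = (X `<=` F).
Proof.
move=> /eqP FE; apply/idP/idP; first by apply: fsubset_trans (sub_closure_of X).
by move=> /closure_ofS; rewrite FE.
Qed.

Lemma closedbP F : reflect (closed_in G [set` F]%classic) (closedb F).
Proof.
apply: (iffP eqP) => [FE|cF].
  have -> : [set` F]%classic = fcl G F; last exact: closed_fcl.
  apply/seteqP; split=> x /=; first by rewrite -{1}FE in_closure_of => /eqP.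
  by move=> xF; rewrite -FE in_closure_of; apply/eqP.
apply/eqP; rewrite eqEfsubset sub_closure_of andbT; apply/fsubsetP => x.
by rewrite in_closure_of => /eqP; apply: (closed_spans cF).
Qed.

(** Moebius inversion on the subsets that satisfy [P], by recursion on the
    cardinal. *)
Lemma mobius (P : pred {fset D}) (f : {fset D} -> int) :
  exists a : {fset D} -> int,
  forall F, P F -> (\sum_(F' | P F' && (F' `<=` F)) a F')%R = f F.
Proof.
suff [a h] : exists a : {fset D} -> int, forall F, P F -> (#|` F| < #|D|.+1)%N ->
    (\sum_(F' | P F' && (F' `<=` F)) a F')%R = f F.
  exists a => F PF; apply: h; rewrite // ltnS -(card_finset D) fsubset_leq_card //.
  by apply/fsubsetP => x _; rewrite !inE.
elim: #|D|.+1 => [|n [a IH]]; first by exists (fun=> 0%R).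
exists (fun F => if #|` F| == n then (f F - \sum_(F' | P F' && (F' `<` F)) a F')%R else a F).
move=> F PF; rewrite ltnS leq_eqVlt => /orP[Fn|Fn]; last first.
  rewrite -IH //; apply: eq_bigr => F' /andP[_ F'F]; case: eqP => // F'n.
  by have := fsubset_leq_card F'F; lia.
rewrite (bigD1 F) /= ?PF ?fsubset_refl // Fn -[RHS](subrK (\sum_(F' | P F' && (F' `<` F)) a F')%R).
congr (_ + _)%R; apply: eq_big => [F'|F' /andP[/andP[_ F'F] nF]].
  by rewrite fproperEneq -andbA andbC (andbC (_ != _)) andbC.
have : (#|` F'| < #|` F|)%N by rewrite fproper_ltn_card // fproperEneq nF.
by rewrite (eqP Fn); case: eqP => // ->; rewrite ltnn.
Qed.

(** If the nullity [|B ∩ F| - g(F)] of every flat is the total weight of the flats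
    below it, the alternating sum of [g] counts the points of the union and
    subtracts the total weight of the flats below some [E i].  It is used with the
    dimension in the whole structure and with the dimension of the trace on [A]. *)
Lemma altsum_closed (g : {fset D} -> nat) (B : {fset D}) (w : {fset D} -> int)
    (k : nat) (E : 'I_k -> {fset D}) :
    (forall F, closedb F ->
       (\sum_(F' | closedb F' && (F' `<=` F)) w F' = Posz #|` B `&` F| - Posz (g F))%R) ->
    (forall i, closedb (E i)) ->
  altsum (fun s => Posz (g (fset_of (\bigcap_(i in [set` s]) [set` E i])%classic)))
  = (Posz #|` [fset x in B | [exists i, x \in E i]]|
     - \sum_(F | closedb F && [exists i, F `<=` E i]) w F)%R.
Proof.
move=> hw fE.
transitivity (altsum (fun s => Posz #|` [fset x in B | [forall i in s, x \in E i]]|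
   - \sum_(F <- index_enum {fset D} | [forall i in s, F `<=` E i])
       if closedb F then w F else 0)%R).
  apply: eq_altsum => s _; set C := fset_of _.
  have inC x : (x \in C) = [forall i in s, x \in E i].
    by rewrite in_fset_of; apply/asboolP/forall_inP.
  have fC : closedb C.
    apply/closedbP; rewrite (_ : [set` C] = \bigcap_(i in [set` s]) [set` E i])%classic.
      by apply: closed_bigcap => i _; apply/closedbP.
    by apply/seteqP; split=> x /=; rewrite in_fset_of => /asboolP.
  have -> : [fset x in B | [forall i in s, x \in E i]] = B `&` C.
    by apply/fsetP => x; rewrite in_fset_cond in_fsetI inC.
  rewrite -[LHS](subKr (Posz #|` B `&` C|)) -hw //; congr (_ - _)%R.
  rewrite -big_mkcondr; apply: eq_bigl => F; rewrite andbC; congr (_ && _).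
  apply/fsubsetP/forall_inP => [h i is_|h x xF].
    by apply/fsubsetP => x /h; rewrite inC => /forall_inP; apply.
  by rewrite inC; apply/forall_inP => i is_; apply: (fsubsetP (h i is_)).
rewrite altsumB altsum_card altsum_sum; congr (_ - _)%R.
by rewrite -big_mkcondr; apply: eq_bigl => F; rewrite andbC.
Qed.

Hypothesis flatG : flat G.
Variables (A : {fset D}) (N : hypergraph D).
Hypothesis sqA : sqsub G A.
(** The next two hypotheses say that the hypergraph induced by [N] on [A] has the
    restriction of [G] as its pregeometry. *)
Hypothesis le_delta : forall Y, Y `<=` A -> (Posz (G Y) <= delta N Y)%R.
Hypothesis delta_attained : forall X, X `<=` A ->
  exists Y, [/\ X `<=` Y, Y `<=` A & (delta N Y <= Posz (G X))%R].

Let R := edges_in N A.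
(** The number of old edges that span [F]. *)
Let beta F : int := #|` [fset e in R | closure_of e == F]|.

Lemma edges_inI Y : edges_in N (A `&` Y) = [fset e in R | e `<=` Y].
Proof. by apply/fsetP => e; rewrite in_fset_cond !edges_inP fsubsetI andbAC. Qed.

(** The trace of a flat is closed in [A], so only the trace itself can attain its
    dimension. *)
Lemma delta_trace_closed F : closedb F -> delta N (A `&` F) = Posz (G (A `&` F)).
Proof.
move=> /eqP fF; have AFA := fsubsetIl A F.
have [Y [AFY YA dY]] := delta_attained AFA; suff YE : Y = A `&` F.
  by apply: le_anti; rewrite le_delta // -{1}YE dY.
apply/eqP; rewrite eqEfsubset AFY andbT fsubsetI YA; apply/fsubsetP => y yY.
have : closure_of (A `&` F) `<=` F by rewrite -[X in _ `<=` X]fF closure_ofS ?fsubsetIr.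
move/fsubsetP; apply; rewrite in_closure_of eqn_leq pdim_mono andbT.
have := le_trans (le_delta YA) dY; rewrite lez_nat; apply: leq_trans; apply: pdimS.
by rewrite fsubUset fsub1set yY.
Qed.

(** Sorts the old edges inside a flat by their closure. *)
Lemma sum_beta F : closedb F ->
  (\sum_(F' | closedb F' && (F' `<=` F)) beta F' = Posz #|` edges_in N (A `&` F)|)%R.
Proof.
move=> fF; have E Q : (Posz #|` [fset e in R | Q e]| = \sum_(e <- R | Q e) 1)%R.
  by rewrite big_fset_condE big_const_seq count_predT iter_addr_0 natz.
rewrite edges_inI E [RHS](partition_big closure_of (fun F' => closedb F' && (F' `<=` F))) /=.
  apply: eq_bigr => F' /andP[fF' F'F]; rewrite /beta E; apply: eq_bigl => e.
  by case: eqP => [eF'|]; rewrite ?andbF // andbT -(closure_of_subE _ fF) eF' F'F.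
by move=> e eF; rewrite closedb_closure_of closure_of_subE.
Qed.

(** The new edges as a multiset, given by a sequence: together with the old edges
    they have predimension at least [G] on every set and at most [G] on flats,
    which determines the dimension.  New edges are not contained in [A], so that
    the hypergraph induced on [A] does not change. *)
Definition realises (s : seq {fset D}) : Prop :=
  [/\ forall Y, (G Y + #|` edges_in N (A `&` Y)| + count (fun e => e `<=` Y) s <= #|` Y|)%N,
      forall F, closedb F ->
        (#|` F| <= G F + #|` edges_in N (A `&` F)| + count (fun e => e `<=` F) s)%N
    & forall e, e \in s -> ~~ (e `<=` A)].

Section Weights.
(** Mason's invariant of the flats of a pregeometry. *)
Variable alpha : {fset D} -> int.
Hypothesis sum_alpha : forall F, closedb F ->
  (\sum_(F' | closedb F' && (F' `<=` F)) alpha F' = Posz #|` F| - Posz (G F))%R.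
(** The number of new edges that should span [F]. *)
Let gamma F : int := (alpha F - beta F)%R.

(** The bounds below are for the flats of a family [Q] that is closed downwards.
    The flats of [Q] themselves are taken as the closed sets [E i], so that the
    flats below some [E i] are exactly those of [Q]. *)
Section DownSet.
Variables (Q : pred {fset D}) (W : {fset D}).
Hypothesis downQ : forall F F', F' `<=` F -> Q F -> Q F'.
Hypothesis QW : forall F, Q F -> F `<=` W.

Let k := #|[pred F | closedb F && Q F]|.
Let E (i : 'I_k) : {fset D} := enum_val i.

Let E_flat i : closedb (E i).
Proof. by have := enum_valP i; rewrite inE => /andP[]. Qed.

Let E_Q i : Q (E i).
Proof. by have := enum_valP i; rewrite inE => /andP[]. Qed.

Let downE F : closedb F && [exists i, F `<=` E i] = closedb F && Q F.
Proof.
have [fF/=|//] := boolP (closedb F).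
apply/existsP/idP => [[i Fi]|QF]; first exact: downQ Fi (E_Q i).
have FQ : F \in [pred F | closedb F && Q F] by rewrite inE fF.
by exists (enum_rank_in FQ F); rewrite /E enum_rankK_in // fsubset_refl.
Qed.

Let closedE i : closed_in G [set` E i]%classic.
Proof. exact/closedbP. Qed.

Let T := fset_of (setT : set D).
Let TI X : T `&` X = X.
Proof. by apply/fsetIidPr/fsubsetP => x _; rewrite in_fset_of; apply/asboolP. Qed.

Let U := fset_of (\bigcup_i [set` E i])%classic.

Let UW : U `<=` W.
Proof.
apply/fsubsetP => x; rewrite in_fset_of => /asboolP[i _ /= xi].
exact: (fsubsetP (QW (E_Q i))).
Qed.

Let inU B : B `&` U = [fset x in B | [exists i, x \in E i]].
Proof.
apply/fsetP => x; rewrite in_fsetI in_fset_cond in_fset_of; congr (_ && _).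
by apply/asboolP/existsP => [[i _ xi]|[i xi]]; exists i.
Qed.

Let altsumG : altsum (fun s => Posz (sdim G (\bigcap_(i in [set` s]) [set` E i])%classic))
  = (Posz #|` U| - \sum_(F | closedb F && Q F) alpha F)%R.
Proof.
rewrite -(eq_bigl _ _ downE) -(TI U) inU.
rewrite -(@altsum_closed G T alpha) // => [|F fF]; last by rewrite TI sum_alpha.
by apply: eq_altsum => s _; rewrite sdim_fin.
Qed.

(** Flatness applied to the flats of [Q] bounds the sum by the nullity of their
    union, and the nullity [|W| - d(W)] is monotone. *)
Lemma sum_alpha_le_nullity : (\sum_(F | closedb F && Q F) alpha F <= Posz #|` W| - Posz (G W))%R.
Proof.
have := flatG closedE (fun i => fin_dim_fin _ _); rewrite sdim_fin -/U.
rewrite [X in (_ <= X)%R]altsumG => h.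
have := pdim_le_card G U W; have := cardfsID U W; rewrite (fsetIidPr UW); lia.
Qed.

(** The relation [A ⊑ G] applied to the flats of [Q] compares the points of their
    union, minus the total [alpha], with the points of the union in [A], minus the
    total [beta]. *)
Lemma sum_gamma_le_card : (\sum_(F | closedb F && Q F) gamma F <= Posz #|` W `\` A|)%R.
Proof.
have /sqsubP/(_ _ _ closedE (fun i => fin_dim_fin _ _)) := sqA; rewrite altsumG.
have -> : altsum (fun s => Posz (G (trace A (\bigcap_(i in [set` s]) [set` E i])%classic)))
  = (Posz #|` A `&` U| - \sum_(F | closedb F && Q F) beta F)%R.
  rewrite -(eq_bigl _ _ downE) inU.
  rewrite -(@altsum_closed (fun F => G (A `&` F))) // => [|F fF].
    apply: eq_altsum => s _; congr (Posz (G _)).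
    by apply/fsetP => x; rewrite in_trace in_fsetI in_fset_of.
  by rewrite sum_beta // -delta_trace_closed // /delta; lia.
rewrite sumrB; have := cardfsID A U; rewrite [U `&` A]fsetIC.
have : (#|` U `\` A| <= #|` W `\` A|)%N by apply/fsubset_leq_card/fsetSD.
set a := (\sum_(F | _) alpha F)%R; set b := (\sum_(F | _) beta F)%R; lia.
Qed.

End DownSet.

Let proper_down E : forall F F' : {fset D}, F' `<=` F -> F `<` E -> F' `<` E.
Proof. by move=> F F'; apply: fsub_proper_trans. Qed.

Lemma sum_closed_top (w : {fset D} -> int) E : closedb E ->
  (\sum_(F | closedb F && (F `<=` E)) w F = w E + \sum_(F | closedb F && (F `<` E)) w F)%R.
Proof.
move=> fE; rewrite (bigD1 E) ?fE ?fsubset_refl //=; congr (_ + _)%R.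
by apply: eq_bigl => F; rewrite fproperEneq -andbA (andbC (_ `<=` _)).
Qed.

Lemma sum_gamma E : closedb E ->
  (\sum_(F | closedb F && (F `<=` E)) gamma F
   = Posz #|` E| - Posz (G E) - Posz #|` edges_in N (A `&` E)|)%R.
Proof. by move=> fE; rewrite sumrB sum_alpha // sum_beta. Qed.

(** The value of [gamma] at [E] is the difference of its sums over all flats below
    [E] and over the proper ones.  If [A ∩ E] spans [E], the first sum is
    [|E \ A|] and [sum_gamma_le_card] bounds the second.  Otherwise no old edge
    spans [E], and [alpha E >= 0] follows from [sum_alpha_le_nullity]. *)
Lemma gamma_ge0 E : closedb E -> (0 <= gamma E)%R.
Proof.
move=> fE; have [EA|EA] := eqVneq (closure_of (A `&` E)) E.
  have := @sum_gamma_le_card (fun F => F `<` E) E (@proper_down E) (fun F => @fproper_sub _ F E).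
  have := sum_gamma fE; rewrite sum_closed_top //.
  have := delta_trace_closed fE; rewrite /delta; have := pdim_closure_of (A `&` E); rewrite EA.
  have := cardfsID A E; rewrite fsetIC; lia.
have b0 : beta E = 0%R.
  rewrite /beta (_ : [fset e in R | closure_of e == E] = fset0) ?cardfs0 //.
  apply/fsetP => e; rewrite in_fset_cond edges_inP in_fset0; apply/negbTE/negP.
  case/andP => /andP[eA _] /eqP eE; move/eqP: EA; apply; apply/eqP.
  rewrite eqEfsubset closure_of_subE // fsubsetIr -{1}eE closure_ofS // fsubsetI eA -eE.
  exact: sub_closure_of.
have := @sum_alpha_le_nullity (fun F => F `<` E) E (@proper_down E) (fun F => @fproper_sub _ F E).
have := sum_alpha fE; rewrite sum_closed_top // /gamma b0; lia.
Qed.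

(** The sum of [gamma] over the flats below [E] is at most [|E \ A| = 0]. *)
Lemma gamma_sub0 E : closedb E -> E `<=` A -> gamma E = 0%R.
Proof.
move=> fE EA.
have := @sum_gamma_le_card (fun F => F `<=` E) E (fun F F' => @fsubset_trans _ F F' E) (fun F h => h).
rewrite (eqP (_ : E `\` A == fset0)) ?fsetD_eq0 // cardfs0 sum_closed_top //.
have := gamma_ge0 fE.
have : (0 <= \sum_(F | closedb F && (F `<` E)) gamma F)%R.
  by apply: sumr_ge0 => F /andP[fF _]; apply: gamma_ge0.
lia.
Qed.

(** With [K] the closure of [A ∩ Y], the flats inside [Y] are split into those inside
    [Y ∩ K], whose total [gamma] is at most [|(Y ∩ K) \ A|], and the others.  For
    the latter [gamma <= alpha], and their total [alpha] is the one of all flats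
    inside [Y] or [K] minus the one of the flats inside [K]: at most
    [|Y \ K| - d(Y) + d(K)].  The old edges inside [Y] number at most
    [|A ∩ Y| - d(K)], and the three bounds add up to [|Y| - d(Y)]. *)
Lemma sum_gamma_le_nullity Y :
  (Posz (G Y) + Posz #|` edges_in N (A `&` Y)| + \sum_(F | closedb F && (F `<=` Y)) gamma F
   <= Posz #|` Y|)%R.
Proof.
pose K := closure_of (A `&` Y).
have h1 := @sum_gamma_le_card (fun F => F `<=` Y `&` K) (Y `&` K)
  (fun F F' => @fsubset_trans _ F F' _) (fun F h => h).
have downQ (F F' : {fset D}) : F' `<=` F -> (F `<=` Y) || (F `<=` K) -> (F' `<=` Y) || (F' `<=` K).
  by move=> F'F /orP[]/(fsubset_trans F'F)->; rewrite ?orbT.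
have QW (F : {fset D}) : (F `<=` Y) || (F `<=` K) -> F `<=` Y `|` K.
  by move=> h; apply: fsubsetU.
have := sum_alpha_le_nullity downQ QW.
rewrite (bigID (fun F => F `<=` K)) /=.
rewrite (eq_bigl (fun F => closedb F && (F `<=` K))) => [|F]; last first.
  by rewrite -andbA; case: (F `<=` K); rewrite ?andbF ?orbT.
rewrite sum_alpha ?closedb_closure_of // => h2.
have h3 : (\sum_(F | closedb F && (F `<=` Y)) gamma F <= Posz #|` (Y `&` K) `\` A|
    + \sum_(F | closedb F && ((F `<=` Y) || (F `<=` K)) && ~~ (F `<=` K)) alpha F)%R.
  rewrite (bigID (fun F => F `<=` K)) /=; apply: lerD.
    by under eq_bigl do rewrite -andbA -fsubsetI.
  rewrite (eq_bigl (fun F => closedb F && (F `<=` Y) && ~~ (F `<=` K))) => [|F]; last first.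
    by case: (F `<=` K); rewrite ?andbF ?orbF.
  rewrite [leRHS](eq_bigl (fun F => closedb F && (F `<=` Y) && ~~ (F `<=` K))) => [|F]; last first.
    by case: (F `<=` K); rewrite ?andbF ?orbF.
  by apply: ler_sum => F _; rewrite /gamma /beta; lia.
have KAY : A `&` Y `<=` K := sub_closure_of _.
have GK : G K = G (A `&` Y) := pdim_closure_of _.
have GYK : (G Y <= G (Y `|` K))%N by apply/pdimS/fsubsetUl.
have := le_delta (fsubsetIl A Y); rewrite /delta.
have c1 := cardfsUI Y K.
have c2 := cardfsID A (Y `&` K).
have c3 : (Y `&` K) `&` A = A `&` Y.
  by rewrite fsetIC fsetIA; apply/fsetIidPl.
rewrite c3 in c2.
set a : int := (\sum_(F | _) alpha F)%R in h2 h3; set b : int := (\sum_(F | _) gamma F)%R in h3 *.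
have {}h3 : (b <= Posz #|` (Y `&` K) `\` A| + a)%R := h3.
have {}h2 : (Posz #|` K| - Posz (G K) + a <= Posz #|` Y `|` K| - Posz (G (Y `|` K)))%R := h2.
move: h2 h3 GK GYK c1 c2; card_lia.
Qed.

Let s0 := flatten [seq nseq `|gamma F| F | F <- enum [pred F | closedb F]].

Lemma realises_closed : realises s0.
Proof.
have cnt Y : Posz (count (fun e => e `<=` Y) s0) = (\sum_(F | closedb F && (F `<=` Y)) gamma F)%R.
  rewrite /s0 count_flatten -map_comp sumnE big_map big_enum_cond /=.
  rewrite -[LHS]natz natr_sum [RHS]big_mkcondr /=; apply: eq_big => [F|F].
    by rewrite inE andbT.
  rewrite andbT inE => fF; rewrite count_nseq natz.
  by case: (F `<=` Y); rewrite /= ?mul0n // mul1n gez0_abs // gamma_ge0.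
split=> [Y|F fF|e].
- by have := sum_gamma_le_nullity Y; rewrite -cnt; lia.
- by have := sum_gamma fF; rewrite -cnt; lia.
case/flattenP => _ /mapP[F + ->]; rewrite mem_enum inE => fF /nseqP[-> g0].
by apply/negP => /(gamma_sub0 fF) g; rewrite g in g0.
Qed.

(** Replacing one of two copies of [S] by [S] minus [x] changes the predimension only
    of sets [Y] that contain [S] except for the point [x]; it decreases by one there.
    Adding [x] to such a [Y] gains one point and two edges, so the new value is at
    least the old predimension of [Y ∪ {x}], hence at least [d(Y)].  The point [x]
    is chosen so that another point of [S] outside [A] remains. *)
Lemma realises_shrink s S : realises (S :: S :: s) ->
  exists2 x, x \in S & realises (S :: (S `\ x) :: s).
Proof.
move=> [ub lb nA].
have /fsubsetPn[y yS yA] := nA S (mem_head _ _).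
have [x xS xy] : exists2 x, x \in S & x != y.
  have [S1|/fsubsetPn[x xS]] := boolP (S `<=` [fset y]); last by rewrite inE; exists x.
  (* two copies of a singleton would give it negative predimension *)
  by have := ub [fset y]; rewrite /= S1 cardfs1; lia.
exists x => //; split=> [Y|F fF|e].
- have := ub Y => /=; have [SY|SY] := boolP (S `<=` Y).
    by rewrite (fsubset_trans (fsubD1set S x) SY).
  have [SxY|SxY] := boolP (S `\ x `<=` Y); last lia.
  have SY' : S `<=` x |` Y by rewrite -fsubDset.
  have xY : x \notin Y.
    by apply: contra SY => xY; rewrite -(mem_fset1U xY).
  have := ub (x |` Y); rewrite /= SY' cardfsU1 xY.
  have := pdim_mono G Y x.
  have : (#|` edges_in N (A `&` Y)| <= #|` edges_in N (A `&` (x |` Y))|)%N.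
    by apply/fsubset_leq_card/edges_inS/fsetIS/fsubsetU1.
  have : (count (fun e => e `<=` Y) s <= count (fun e => e `<=` x |` Y) s)%N.
    by apply: sub_count => e eY; apply: (fsubset_trans eY); apply: fsubsetU1.
  card_lia.
- apply: leq_trans (lb F fF) _ => /=; have [SF|_] := boolP (S `<=` F); last lia.
  by rewrite (fsubset_trans (fsubD1set S x) SF).
rewrite !inE => /or3P[/eqP->|/eqP->|es]; first by apply: nA; rewrite inE eqxx.
  by apply/negP => /fsubsetP/(_ y); rewrite !inE eq_sym xy yS => /(_ isT); apply/negP.
by apply: nA; rewrite !inE es !orbT.
Qed.

Lemma realises_perm s s' : perm_eq s s' -> realises s -> realises s'.
Proof.
move=> ss' [ub lb nA]; split=> [Y|F fF|e]; rewrite -?(permP ss') //.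
- exact: lb.
- by rewrite -(perm_mem ss'); apply: nA.
Qed.

(** Each replacement decreases the total size of the edges, so repetitions
    eventually disappear. *)
Lemma realises_uniq : exists2 s, uniq s & realises s.
Proof.
suff h n (s : seq {fset D}) : (sumn [seq #|` e| | e <- s] < n)%N -> realises s -> exists2 s, uniq s & realises s.
  exact: h realises_closed.
elim: n s => // n IH s; rewrite ltnS => sn rs.
have [us|nus] := boolP (uniq s); first by exists s.
have [S Ss cS] : exists2 S, S \in s & S \in rem S s.
  have /allPn[S Ss] : ~~ all (fun S => count_mem S s == 1%N) s.
    apply: contra nus => /allP h; apply: count_mem_uniq => S.
    by have [/h/eqP|/count_memPn] := boolP (S \in s).
  have := Ss; rewrite -has_pred1 has_count => c0 c1; exists S => //.
  rewrite -has_pred1 has_count count_rem Ss /= eqxx; move: c0 c1; card_lia.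
have p : perm_eq s (S :: S :: rem S (rem S s)).
  by apply: perm_trans (perm_to_rem Ss) _; rewrite perm_cons perm_to_rem.
have [x xS rs'] := realises_shrink (realises_perm p rs).
apply: IH rs'; apply: leq_trans sn.
have /perm_sumn -> := perm_map (fun e : {fset D} => #|` e|) p.
by rewrite /= (cardfsD1 x S) xS; set t := sumn _; card_lia.
Qed.

End Weights.

Lemma realises_exists : exists2 s, uniq s & realises s.
Proof.
have [alpha h] := mobius closedb (fun F => Posz #|` F| - Posz (G F))%R.
exact: (realises_uniq h).
Qed.

(** Strength of [A] is automatic: the predimension
    of [A] equals [d(A)], and [d(A) <= d(Y) <= delta Y] for [Y] containing [A]. *)
Theorem realisation : exists B : hypergraph D,
  [/\ forall e, e `<=` A -> (e \in edge B) = (e \in edge N),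
      hstrong B A
    & exists B0 : hstrong B fset0, forall X, hpregeometry B0 X = G X].
Proof.
have [s us [ub lb nA]] := realises_exists.
pose ed := [pred e : {fset D} | (e `<=` A) && (e \in edge N) || (e \in s)].
have ed0 e : e \in ed -> e != fset0.
  case/orP => [/andP[_ /edge_neq0]//|/nA]; apply: contraNneq => ->; exact: fsub0set.
pose B := Hypergraph ed0.
have dB Y : delta B Y = (Posz #|` Y| - Posz (#|` edges_in N (A `&` Y)| + count (fun e => e `<=` Y) s)%N)%R.
  rewrite /delta; congr (_ - Posz _)%R.
  have -> : edges_in B Y = edges_in N (A `&` Y) `|` [fset e in [seq e <- s | e `<=` Y]].
    apply/fsetP => e; rewrite in_fsetU !edges_inP fsubsetI in_fset /= mem_filter.
    rewrite [e \in edge B]inE; case: (e `<=` Y); case: (e `<=` A) => //=; by rewrite andbT.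
  have := cardfsUI (edges_in N (A `&` Y)) [fset e in [seq e <- s | e `<=` Y]].
  rewrite card_fseq undup_id ?filter_uniq // size_filter.
  suff -> : edges_in N (A `&` Y) `&` [fset e in [seq e <- s | e `<=` Y]] = fset0.
    by rewrite cardfs0 addn0.
  apply/fsetP => e; rewrite in_fsetI edges_inP in_fset /= mem_filter in_fset0.
  by apply/negP => /andP[/andP[eAY _] /andP[_ /nA]]; rewrite (fsubset_trans eAY) ?fsubsetIl.
have lbB Y : (Posz (G Y) <= delta B Y)%R by rewrite dB; have := ub Y; lia.
have B0 : hstrong B fset0.
  apply/hstrongP => Y _; apply: (le_trans _ (lbB Y)).
  by rewrite /delta edges_in0 cardfs0 subrr.
exists B; split.
- move=> e eA; rewrite inE /= eA /=; case: (boolP (e \in s)) => [/nA|]; last by rewrite orbF.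
  by rewrite eA.
- apply/hstrongP => Y AY; apply: (le_trans _ (lbB Y)).
  apply: (@le_trans _ _ (Posz (G A))); last by rewrite lez_nat pdimS.
  have [Z [AZ ZA dZ]] := delta_attained (fsubset_refl A); apply: le_trans dZ.
  have -> : Z = A by apply/eqP; rewrite eqEfsubset ZA.
  rewrite dB fsetIid /delta (@eq_in_count _ _ pred0) ?count_pred0 ?addn0 // => e /nA.
  by move/negbTE.
- exists B0 => X; apply: hpdim_unique => [Y XY|].
    by apply: le_trans (lbB Y); rewrite lez_nat pdimS.
  exists (closure_of X); rewrite ?sub_closure_of // dB.
  have := lb _ (closedb_closure_of X); rewrite pdim_closure_of; lia.
Qed.
End Realization.

(** * Embeddings of hypergraphs *)

Lemma imfset_imfset (I J K : choiceType) (f : I -> J) (g : J -> K) (X : {fset I}) :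
  g @` (f @` X) = (fun x => g (f x)) @` X.
Proof. by rewrite -imfset_comp. Qed.

(** Every finite subset of an image is the image of its preimage. *)
Lemma imfset_preim (D T : choiceType) (f : D -> T) (Y : {fset D}) (e : {fset T}) :
  e `<=` f @` Y -> f @` [fset y in Y | f y \in e] = e.
Proof.
move=> eY; apply/fsetP => x; apply/imfsetP/idP => /= [[y]|xe].
  by rewrite in_fset_cond => /andP[_ yY] ->.
have /imfsetP[y /= yY xE] := fsubsetP eY x xe.
by exists y; rewrite // in_fset_cond yY -xE.
Qed.

Lemma in_imfset_inj (D T : choiceType) (f : D -> T) (Y : {fset D}) x :
  (forall y, y \in Y -> f y = f x -> y = x) -> (f x \in f @` Y) = (x \in Y).
Proof.
move=> fI; apply/imfsetP/idP => [[y /= yY fxy]|xY]; last by exists x.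
by rewrite -(fI y).
Qed.

(** Stated for maps that are injective and preserve edges only on [A], since a
    partial isomorphism is a total map that is meaningful only on its domain. *)
Lemma delta_imfset (D T : choiceType) (B : hypergraph D) (M : hypergraph T)
    (f : D -> T) (A : {fset D}) : {in A &, injective f} ->
    (forall e, e `<=` A -> (f @` e \in edge M) = (e \in edge B)) ->
  forall Y, Y `<=` A -> delta M (f @` Y) = delta B Y.
Proof.
move=> fI fE Y YA; have fIY : {in Y &, injective f}.
  by move=> x y /(fsubsetP YA) xA /(fsubsetP YA) yA; apply: fI.
rewrite /delta card_in_imfset //; congr (_ - Posz _)%R.
have -> : edges_in M (f @` Y) = (fun e : {fset D} => f @` e) @` edges_in B Y.
  apply/fsetP => e; rewrite edges_inP; apply/andP/imfsetP => /= [[eY eM]|[d]].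
    exists [fset y in Y | f y \in e]; last by rewrite imfset_preim.
    rewrite edges_inP fset_sub -fE ?imfset_preim //.
    exact: fsubset_trans (fset_sub _ _) YA.
  rewrite edges_inP => /andP[dY dB] ->; split; first by apply/subset_imfset/fsubsetP.
  by rewrite fE // (fsubset_trans dY).
rewrite card_in_imfset // => d e /=; rewrite !edges_inP => /andP[dY _] /andP[eY _] de.
apply/fsetP => x; have [xY|xY] := boolP (x \in Y).
  rewrite -(@in_imfset_inj _ _ f d) => [|y yd /fIY->//]; last exact: (fsubsetP dY).
  by rewrite de in_imfset_inj // => y ye /fIY-> //; apply: (fsubsetP eY).
by rewrite (contraNF (fsubsetP dY x)) ?(contraNF (fsubsetP eY x)).
Qed.

Section Embedding.
Variables (D : finType) (T : choiceType) (B : hypergraph D) (M : hypergraph T).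
Variable f : D -> T.
Hypothesis fB : hypergraph_embedding B M f.

Lemma delta_embedding Y : delta M (f @` Y) = delta B Y.
Proof.
apply: (@delta_imfset _ _ _ _ _ (fset_of (setT : set D))).
- by move=> x y _ _; apply: fB.1.
- by move=> e _; apply: fB.2.
- by apply/fsubsetP => x _; rewrite in_fset_of; apply/asboolP.
Qed.

Lemma hstrong_embedding Q : hstrong M (f @` Q) -> hstrong B Q.
Proof.
move=> /hstrongP h; apply/hstrongP => Y QY; rewrite -!delta_embedding; apply: h.
by apply/subset_imfset/fsubsetP.
Qed.

(** A strong image contains, for each of its subsets, a set that attains the
    dimension, because intersecting with it does not increase [delta].  For the
    inclusion of a strong finite set this says that its induced hypergraph induces
    the subpregeometry. *)
Lemma hpdim_embedding (B0 : hstrong B fset0) (M0 : hstrong M fset0) X :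
  hstrong M [fset f u | u : D] -> hpregeometry M0 (f @` X) = hpregeometry B0 X.
Proof.
move=> hf; apply: hpdim_unique => [Z XZ|]; last first.
  have [Y XY ->] := hpdim_attained B0 X; exists (f @` Y); last by rewrite delta_embedding.
  by apply/subset_imfset/fsubsetP.
apply: le_trans (delta_capr Z hf).
have -> : [fset f u | u : D] `&` Z = f @` [fset u : D | f u \in Z].
  apply/fsetP => x; rewrite in_fsetI; apply/andP/imfsetP => /= [[/imfsetP[u _ ->] uZ]|[u]].
    by exists u; rewrite // !inE.
  by rewrite !inE /= => uZ ->; split=> //; apply/imfsetP; exists u.
rewrite delta_embedding; apply: hpdim_le_delta; apply/fsubsetP => u uX.
by rewrite !inE /=; apply: (fsubsetP XZ); apply/imfsetP; exists u.
Qed.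

End Embedding.

Lemma imfset_val (T : choiceType) (A : {fset T}) : [fset val a | a : A] = A.
Proof.
apply/fsetP => x; apply/imfsetP/idP => /= [[a _ ->]|xA]; first exact: valP.
by exists [` xA].
Qed.

Lemma subhypergraph_embedding (T : choiceType) (M : hypergraph T) (A : {fset T}) :
  hypergraph_embedding (subhypergraph M A) M val.
Proof. by split=> [|e]; [exact: val_inj | ]. Qed.

Lemma closed_sub (U : choiceType) (G : pregeometry U) (A : {fset U}) (Y : set U) :
  closed_in G Y -> closed_in (subpregeometry G A) (val @^-1` Y)%classic.
Proof.
move=> cY; apply: closed_inP => C y CY yC /=.
apply: (@closed_spans _ _ _ (val @` C) _ cY).
  by move=> x /= /imfsetP[z /= zC ->]; apply: CY.
by move: yC; rewrite /= /subpdim imfsetU1.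
Qed.

(** * Back and forth *)

Section BackAndForth.
Variables (T U : countType) (M : hypergraph T) (hM : generic_hypergraph M).
Variables (G : pregeometry U) (hG : generic_flat_pregeometry G).

Let M0 := generic_hypergraph_strong0 hM.
Let GM := hpregeometry M0.

(** A finite partial isomorphism is given by its graph, so that extension is
    inclusion and both directions are symmetric. *)
Definition strong_iso (R : {fset T * U}) : Prop :=
  [/\ {in R &, injective fst}, {in R &, injective snd}, hstrong M (fst @` R),
      sqsub G (snd @` R)
    & forall X, X `<=` R -> GM (fst @` X) = G (snd @` X)].

Lemma strong_iso_graph (W : finType) (i : W -> T) (j : W -> U) :
    injective i -> injective j -> hstrong M [fset i w | w : W] ->
    sqsub G [fset j w | w : W] ->
    (forall X : {fset W}, GM (i @` X) = G (j @` X)) ->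
  strong_iso [fset (i w, j w) | w : W].
Proof.
move=> iI jI hi hj ij; split.
- by move=> _ _ /imfsetP[w _ ->] /imfsetP[v _ ->] /= /iI->.
- by move=> _ _ /imfsetP[w _ ->] /imfsetP[v _ ->] /= /jI->.
- by rewrite -imfset_comp.
- by rewrite -imfset_comp.
move=> X XR; have -> : X = (fun w => (i w, j w)) @` [fset w : W | (i w, j w) \in X].
  apply/fsetP => p; apply/idP/imfsetP => /= [pX|[w]]; last by rewrite !inE => wX ->.
  by have /imfsetP[w _ pE] := fsubsetP XR p pX; exists w; rewrite // !inE -pE.
by move: [fset w : W | _] => X'; rewrite !imfset_imfset; apply: ij.
Qed.

(** Only [∅ ⊑ G] requires an argument: it says that [Delta] is nonnegative in [G].
    [Delta] is nonnegative in every finite [A ⊑ G], which is flat, and the relation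
    [A ⊑ G] transfers this to [G]. *)
Lemma strong_iso0 : strong_iso fset0.
Proof.
split; rewrite ?imfset0 //; last first.
  by move=> X; rewrite fsubset0 => /eqP->; rewrite !imfset0 !pdim0.
apply/sqsubP => k E cE fE.
have -> : altsum (fun s => Posz (G (trace fset0 (\bigcap_(i in [set` s]) E i)%classic))) = 0%R.
  rewrite /altsum big1 // => s _; rewrite (_ : trace _ _ = fset0) ?pdim0 ?mulr0 //.
  by apply/fsetP => x; rewrite in_trace.
have [subC _ _ cover] := hG; have [A _ sA] := cover fset0.
have := subC A sA k (fun i => val @^-1` E i)%classic (fun i => closed_sub A (cE i)).
move=> /(_ (fun i => fin_dim_fin _ _)) fl; apply: le_trans (le_trans fl _) => //.
exact: sA.
Qed.

Lemma strong_iso_pull R (Y : {fset U}) : strong_iso R -> Y `<=` snd @` R ->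
  GM (fst @` [fset p in R | p.2 \in Y]) = G Y.
Proof. by move=> [_ _ _ _ h] YR; rewrite h ?fset_sub // imfset_preim. Qed.

(** The finite hypergraph [N <= M] that contains [x] and the domain is flat, and the
    range embeds into it with strong image. *)
Lemma extend_left R x : strong_iso R ->
  exists R', [/\ strong_iso R', R `<=` R' & x \in fst @` R'].
Proof.
move=> gR; have [I1 I2 s1 s2 dR] := gR.
have [subM _ _ coverM] := hM; have [_ _ extG _] := hG.
have [N xN sN] := coverM (x |` (fst @` R)); move: xN; rewrite fsubUset fsub1set => /andP[xN RN].
have N0 : hstrong (subhypergraph M N) fset0 := subM N sN.
have embN := subhypergraph_embedding M N.
have GN (Y : {fset N}) : GM (val @` Y) = hpregeometry N0 Y.
  by apply: (hpdim_embedding embN); rewrite imfset_val.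
(* [g] is the inverse of the partial isomorphism, with values in [N] *)
have gP (a : snd @` R) : exists n : N, (val n, val a) \in R.
  have /imfsetP[[t u] /= tuR aE] := valP a.
  have tN : t \in N by apply: (fsubsetP RN); apply/imfsetP; exists (t, u).
  by exists [` tN]; rewrite aE.
have [g gR'] := choice gP.
have pE (t : T) (a : snd @` R) : (t, val a) \in R -> val (g a) = t.
  by move=> taR; have := I2 _ _ (gR' a) taR erefl; case.
have gI : injective g.
  by move=> a b ab; apply: val_inj; have := I1 _ _ (gR' a) (gR' b) (congr1 val ab); case.
have embg : pregeometry_embedding (subpregeometry G (snd @` R)) (hpregeometry N0) g.
  split=> // Y; rewrite -GN /= /subpdim -(strong_iso_pull gR); last first.
    by apply/fsubsetP => _ /imfsetP[a _ ->]; apply: valP.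
  congr (GM _); rewrite -imfset_comp; apply/fsetP => t; apply/imfsetP/imfsetP => /= -[].
    move=> a aY ->; exists (val (g a), val a) => //.
    by rewrite in_fset_cond gR' /=; apply/imfsetP; exists a.
  case=> t' u; rewrite in_fset_cond /= => /andP[tuR /imfsetP[a /= aY uE]] ->.
  by exists a => //; apply/esym/pE; move: tuR; rewrite uE.
have gim : val @` [fset g a | a : snd @` R] = fst @` R.
  rewrite -imfset_comp; apply/fsetP => t; apply/imfsetP/imfsetP => /= -[].
    by move=> a _ ->; exists (val (g a), val a).
  case=> t' u tuR ->; have uR : u \in snd @` R by apply/imfsetP; exists (t', u).
  by exists [` uR] => //; apply/esym/pE.
have sg : sqsub (hpregeometry N0) [fset g a | a : snd @` R].
  by apply: hstrong_sqsub; apply: (hstrong_embedding embN); rewrite gim.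
have [f [[fI fE] fg fs]] := extG _ s2 _ _ (@hpregeometry_flat _ _ N0) g embg sg.
exists [fset (val n, f n) | n : N]; split.
- apply: strong_iso_graph => //; first exact: val_inj.
    by rewrite imfset_val.
  by move=> X; rewrite GN fE.
- apply/fsubsetP => -[t u] tuR; have uR : u \in snd @` R by apply/imfsetP; exists (t, u).
  apply/imfsetP; exists (g [` uR]) => //=.
  by rewrite fg (pE t).
by rewrite -imfset_comp; apply/imfsetP; exists [` xN].
Qed.

(** Gives the default value of a map into [T] outside its meaningful domain. *)
Lemma generic_hypergraph_inhabited : inhabited T.
Proof.
have e0 (e : {fset unit}) : e \in (pred0 : {pred {fset unit}}) -> e != fset0 by [].
have [_ emb _ _] := hM; have [|f _ _] := emb unit (Hypergraph e0); last by exists; exact: f tt.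
apply/hstrongP => Y _; rewrite /delta edges_in0 cardfs0 subr0 /=.
rewrite (_ : edges_in _ _ = fset0) ?cardfs0 ?subr0 //.
by apply/fsetP => e; rewrite edges_inP inE andbF.
Qed.

(** The hypergraph on the domain is transported along [k] to the part [A] of [D]
    that corresponds to the range, and extended to [D] by [realisation]. *)
Lemma extend_right R y : strong_iso R ->
  exists R', [/\ strong_iso R', R `<=` R' & y \in snd @` R'].
Proof.
move=> gR; have [I1 I2 s1 s2 dR] := gR.
have [_ _ extM _] := hM; have [subG _ _ coverG] := hG.
have [D yD sD] := coverG (y |` (snd @` R)); move: yD; rewrite fsubUset fsub1set => /andP[yD RD].
have [t0] := generic_hypergraph_inhabited.
pose A := [fset d : D | val d \in snd @` R].
have inA (d : D) : (d \in A) = (val d \in snd @` R) by rewrite !inE.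
(* [k] is the inverse of the partial isomorphism on the part [A] of [D] *)
have kP (d : D) : exists t, d \in A -> (t, val d) \in R.
  have [/imfsetP[[t u] /= tuR dE]|dR'] := boolP (val d \in snd @` R); last first.
    by exists t0; rewrite inA (negbTE dR').
  by exists t; rewrite dE.
have [k kR] := choice kP.
have kE d t : (t, val d) \in R -> k d = t.
  move=> tdR; have dA : d \in A by rewrite inA; apply/imfsetP; exists (t, val d).
  by have := I2 _ _ (kR d dA) tdR erefl; case.
have kI : {in A &, injective k}.
  move=> c d cA dA cd; apply: val_inj.
  by have := I1 _ _ (kR c cA) (kR d dA) cd; case.
pose ed := [pred e : {fset D} | k @` e \in edge M].
have ed0 e : e \in ed -> e != fset0.
  by rewrite inE => /edge_neq0; apply: contra_neq => ->; rewrite imfset0.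
pose N := Hypergraph ed0.
have dN Y : Y `<=` A -> delta M (k @` Y) = delta N Y by apply: delta_imfset.
have kA Y : Y `<=` A -> GM (k @` Y) = G (val @` Y).
  move=> YA; rewrite -(strong_iso_pull gR); last first.
    by apply/fsubsetP => _ /imfsetP[d /= dY ->]; rewrite -inA (fsubsetP YA).
  congr (GM _); apply/fsetP => t; apply/imfsetP/imfsetP => /= -[].
    move=> d dY ->; exists (k d, val d) => //.
    by rewrite in_fset_cond kR ?(fsubsetP YA) //=; apply/imfsetP; exists d.
  case=> t' u; rewrite in_fset_cond /= => /andP[tuR /imfsetP[d /= dY uE]] ->.
  by exists d => //; apply/esym/kE; move: tuR; rewrite uE.
have kim : k @` A = fst @` R.
  apply/fsetP => t; apply/imfsetP/imfsetP => /= -[].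
    by move=> d dA ->; exists (k d, val d); rewrite ?kR.
  case=> t' u tuR ->; have uD : u \in D by apply: (fsubsetP RD); apply/imfsetP; exists (t', u).
  exists [` uD]; last exact/esym/kE.
  by rewrite inA; apply/imfsetP; exists (t', u).
have le_delta Y : Y `<=` A -> (Posz (subpregeometry G D Y) <= delta N Y)%R.
  move=> YA; rewrite -dN // /= /subpdim -kA //; apply: hpdim_le_delta; exact: fsubset_refl.
have delta_attained X : X `<=` A -> exists Y,
    [/\ X `<=` Y, Y `<=` A & (delta N Y <= Posz (subpregeometry G D X))%R].
  move=> XA; have [Z XZ ZE] := hpdim_attained M0 (k @` X).
  exists [fset d in A | k d \in Z]; split; last 1 first.
  - rewrite /= /subpdim -kA // ZE -dN ?fset_sub //.
    apply: le_trans (delta_capr Z s1); rewrite -kim.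
    rewrite -(@imfset_preim _ _ k A (k @` A `&` Z)) ?fsubsetIl //.
    rewrite (_ : [fset d in A | k d \in Z] = [fset d in A | k d \in k @` A `&` Z]) //.
    apply/fsetP => d; rewrite !in_fset_cond in_fsetI; case: (boolP (d \in A)) => //= dA.
    by rewrite (_ : k d \in k @` A) //; apply/imfsetP; exists d.
  - apply/fsubsetP => d dX; rewrite in_fset_cond (fsubsetP XA) //=.
    by apply: (fsubsetP XZ); apply/imfsetP; exists d.
  - exact: fset_sub.
have [B [BN BA [B0 BE]]] := realisation (subG D sD) (sqsub_restrict RD sD s2) le_delta delta_attained.
have gP (a : fst @` R) : exists d : D, (val a, val d) \in R.
  have /imfsetP[[t u] /= tuR aE] := valP a.
  have uD : u \in D by apply: (fsubsetP RD); apply/imfsetP; exists (t, u).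
  by exists [` uD]; rewrite aE.
have [g gR'] := choice gP.
have kg a : k (g a) = val a by apply: kE.
have gA a : g a \in A by rewrite inA; apply/imfsetP; exists (val a, val (g a)).
have gim : [fset g a | a : fst @` R] = A.
  apply/fsetP => d; apply/imfsetP/idP => /= [[a _ ->//]|dA].
  have tR : k d \in fst @` R by rewrite -kim; apply/imfsetP; exists d.
  by exists [` tR] => //; apply: kI => //; rewrite kg.
have embg : hypergraph_embedding (subhypergraph M (fst @` R)) B g.
  split=> [a b ab|e]; first by apply: val_inj; rewrite -!kg ab.
  rewrite BN; last by apply/fsubsetP => _ /imfsetP[a _ ->].
  suff gE : k @` (g @` e) = val @` e by rewrite -[LHS]/(k @` (g @` e) \in edge M) gE.
  by rewrite imfset_imfset; apply: eq_imfset.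
have [|f [embf fg fs]] := extM _ s1 _ B B0 g embg; first by rewrite gim.
exists [fset (f d, val d) | d : D]; split.
- apply: strong_iso_graph => //; [exact: embf.1 | exact: val_inj | by rewrite imfset_val |].
  by move=> X; rewrite (hpdim_embedding embf B0 M0) // BE.
- apply/fsubsetP => -[t u] tuR.
  have tR : t \in fst @` R by apply/imfsetP; exists (t, u).
  apply/imfsetP; exists (g [` tR]) => //=; rewrite fg /=; congr (_, _).
  by have := I1 _ _ (gR' [` tR]) tuR erefl; case.
by rewrite -imfset_comp; apply/imfsetP; exists [` yD].
Qed.

(** Stage [n] of the construction puts the [n]-th point of each side into the
    partial isomorphism. *)
Lemma strong_iso_step (R : {fset T * U}) (n : nat) : strong_iso R -> exists R',
  [/\ strong_iso R', R `<=` R', forall x : T, choice.pickle x = n -> x \in fst @` R'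
    & forall y : U, choice.pickle y = n -> y \in snd @` R'].
Proof.
move=> gR.
have [R1 [g1 RR1 h1]] : exists R1, [/\ strong_iso R1, R `<=` R1 &
    forall x : T, choice.pickle x = n -> x \in fst @` R1].
  have [[x xn]|nx] := EM (exists x : T, choice.pickle x = n); last first.
    by exists R; split=> // x xn; case: nx; exists x.
  have [R1 [g1 RR1 xR1]] := extend_left x gR; exists R1; split=> // z zn.
  by rewrite (pcan_inj choice.pickleK (etrans zn (esym xn))).
have [[y yn]|ny] := EM (exists y : U, choice.pickle y = n); last first.
  by exists R1; split=> // y yn; case: ny; exists y.
have [R2 [g2 RR2 yR2]] := extend_right y g1; exists R2; split=> //.
- exact: fsubset_trans RR1 RR2.
- by move=> x /h1; apply/fsubsetP/subset_imfset/fsubsetP.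
by move=> z zn; rewrite (pcan_inj choice.pickleK (etrans zn (esym yn))).
Qed.

Lemma back_and_forth : pregeometry_isomorphic GM G.
Proof.
have stepP (Rn : {fset T * U} * nat) : exists R', strong_iso Rn.1 ->
    [/\ strong_iso R', Rn.1 `<=` R', forall x : T, choice.pickle x = Rn.2 -> x \in fst @` R'
      & forall y : U, choice.pickle y = Rn.2 -> y \in snd @` R'].
  have [gR|nR] := EM (strong_iso Rn.1); last by exists fset0.
  by have [R' h] := strong_iso_step Rn.2 gR; exists R'.
have [next nextP] := choice stepP.
pose r := fix r n := if n is m.+1 then next (r m, m) else fset0.
have rg n : strong_iso (r n).
  by elim: n => [|n IH]; [exact: strong_iso0 | have [] := nextP (r n, n) IH].
have rS m n : (m <= n)%N -> r m `<=` r n.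
  elim: n => [|n IH]; first by rewrite leqn0 => /eqP->.
  rewrite leq_eqVlt ltnS => /orP[/eqP->//|/IH mn]; apply: fsubset_trans mn _.
  by have [] := nextP (r n, n) (rg n).
have rT (x : T) : exists y, exists n, (x, y) \in r n.
  have [_ _ /(_ x erefl) + _] := nextP (r (choice.pickle x), choice.pickle x) (rg _).
  by case/imfsetP => -[t u] /= h ->; exists u, (choice.pickle x).+1.
have rU (y : U) : exists x, exists n, (x, y) \in r n.
  have [_ _ _ /(_ y erefl)] := nextP (r (choice.pickle y), choice.pickle y) (rg _).
  by case/imfsetP => -[t u] /= h ->; exists t, (choice.pickle y).+1.
have [f fP] := choice rT; have [g gP] := choice rU; exists f.
  exists g => [x|y].
    have [n xn] := fP x; have [m gm] := gP (f x); have [_ I2 _ _ _] := rg (maxn n m).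
    have := I2 _ _ (fsubsetP (rS _ _ (leq_maxr n m)) _ gm) (fsubsetP (rS _ _ (leq_maxl n m)) _ xn).
    by move=> /(_ erefl) [].
  have [n yn] := gP y; have [m fm] := fP (g y); have [I1 _ _ _ _] := rg (maxn n m).
  have := I1 _ _ (fsubsetP (rS _ _ (leq_maxr n m)) _ fm) (fsubsetP (rS _ _ (leq_maxl n m)) _ yn).
  by move=> /(_ erefl) [].
move=> X; have [n Xn] : exists n, [fset (x, f x) | x in X] `<=` r n.
  elim/fset1U_rect: X => [|x X _ [n Xn]]; first by exists 0%N; rewrite imfset0.
  have [m xm] := fP x; exists (maxn n m); rewrite imfsetU1 fsubUset fsub1set.
  rewrite (fsubsetP (rS _ _ (leq_maxr n m))) //.
  exact: fsubset_trans Xn (rS _ _ (leq_maxl n m)).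
have [_ _ _ _ /(_ _ Xn)] := rg n; rewrite -!imfset_comp /= => h.
by rewrite -h; congr (GM _); rewrite imfset_id.
Qed.

End BackAndForth.

Theorem proposition3p1p12 (T U : countType)
    (M : hypergraph T) (hM : generic_hypergraph M)
    (G : pregeometry U) (hG : generic_flat_pregeometry G) :
  pregeometry_isomorphic (hpregeometry (generic_hypergraph_strong0 hM)) G.
Proof. exact: back_and_forth. Qed.
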